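(* Let $(M,J,\bar\omega,\bar g)$ be a compact Kähler manifold of real dimension $2n$ that is almost Einstein, with constant $\lambda\in\mathbb{R}$ and smooth function $\psi:M\to\mathbb{R}$ such that $\bar\rho=\lambda\bar\omega+n\,\mathrm{d}\mathrm{d}^c\psi$. Let $\mathcal{S}$ be the infinite dimensional manifold of all compact $n$-dimensional submanifolds of $M$, and define conformally rescaled Riemannian metrics on $M$ by $$\tilde g=e^{2\psi}\bar g,\qquad \hat g=e^{\frac{2n}{n+2}\psi}\bar g.$$ Then the generalized mean curvature flow $\frac{\partial F}{\partial t}=K$ is the negative gradient flow of the volume functional $\mathrm{Vol}_{\tilde g}$ on $\mathcal{S}$ with respect to the $L^2$-metric $\langle\cdot,\cdot\rangle_{\hat g,L^2}$; that is, for every $N\in\mathcal{S}$ and every normal vector field $Y\in\Gamma(\nu N)$, the first variation of $\mathrm{Vol}_{\tilde g}$ at $N$ in direction $Y$ satisfies $$\delta_Y\mathrm{Vol}_{\tilde g}(N)=-\langle K,Y\rangle_{\hat g,L^2},$$ where $K$ is the generalized mean curvature vector field of $N$.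
   Context: Conventions: $J$ is the complex structure, $\bar\omega$ the Kähler form and $\bar g$ the Kähler metric, related by $\bar g(JX,Y)=\bar\omega(X,Y)$; $\bar\nabla$ is the Levi-Civita connection of $\bar g$. The Ricci form is $\bar\rho(X,Y)=\bar{R}ic(JX,Y)$, where $\bar{R}ic$ is the Ricci tensor of $\bar g$. For a function $\psi$, $\mathrm{d}^c\psi=-\mathrm{d}\psi\circ J$ (so $\mathrm{d}\mathrm{d}^c=2i\partial\bar\partial$). A Kähler manifold of complex dimension $n$ is called almost Einstein if $\bar\rho=\lambda\bar\omega+n\,\mathrm{d}\mathrm{d}^c\psi$ for some constant $\lambda\in\mathbb{R}$ and some smooth function $\psi$; such $\lambda,\psi$ are fixed. Submanifolds are immersed and (being compact) without boundary. For a submanifold $N$ given by an immersion $F:N\to M$, with normal bundle $\nu N$ and $\bar g$-orthogonal projection $\pi_{\nu N}$ onto it, the second fundamental form is $\mathrm{II}(X,Y)=\pi_{\nu N}(\bar\nabla_{\mathrm{d}F(X)}\mathrm{d}F(Y))$, the mean curvature vector field $H$ is the trace of $\mathrm{II}$ with respect to $F^*\bar g$ (no normalizing factor), and the generalized mean curvature vector field is $K=H-n\,\pi_{\nu N}(\bar\nabla\psi)$, with $\bar\nabla\psi$ the $\bar g$-gradient of $\psi$. The tangent space of $\mathcal{S}$ at $N$ consists of the normal vector fields along $N$. For a Riemannian metric $g$ on $M$, the $L^2$-metric on $\mathcal{S}$ is $\langle Y,Z\rangle_{g,L^2}=\int_N g(Y,Z)\,\mathrm{d}V_g$ for $Y,Z\in\Gamma(\nu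 N)$, where $\mathrm{d}V_g$ is the volume measure of the metric on $N$ induced by $g$, and $\mathrm{Vol}_g(N)=\int_N\mathrm{d}V_g$. The first variation $\delta_Y\mathrm{Vol}_g(N)$ is the derivative at $s=0$ of $\mathrm{Vol}_g$ along a smooth family of immersions $F_s$ of $N$ with $F_0=F$ and $\frac{\partial F_s}{\partial s}|_{s=0}=Y$. *)

(* Defs.v *)
From HB Require Import structures.
From mathcomp Require Import all_boot all_order all_algebra.
From mathcomp Require Import all_classical all_reals all_analysis.

Set Implicit Arguments.
Unset Strict Implicit.
Unset Printing Implicit Defensive.
Import Order.TTheory GRing.Theory Num.Theory.
Import numFieldNormedType.Exports.
Local Open Scope classical_set_scope.
Local Open Scope ring_scope.

(* Only meant for U open and V finite-dimensional. *)
Fixpoint Ck {R : realType} {V W : normedModType R} (k : nat)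
    (U : set V) (f : V -> W) : Prop :=
  match k with
  | 0 => forall x, U x -> {for x, continuous f}
  | k'.+1 => (forall x, U x -> differentiable f x) /\
             forall v : V, Ck k' U (fun x => 'D_v f x)
  end.

Definition smooth_on {R : realType} {V W : normedModType R}
  (U : set V) (f : V -> W) : Prop := forall k, Ck k U f.

Definition partial {R : realType} {m : nat} {W : normedModType R}
  (i : 'I_m) (f : 'rV[R]_m -> W) (u : 'rV[R]_m) : W := 'D_(delta_mx 0 i) f u.

(* [fwd] and [bwd] are total functions; only their values on [dom] and on
   [fwd @` dom] are meaningful. *)
Record chart (R : realType) (T : topologicalType) (m : nat) := Chart {
  dom : set T ;
  fwd : T -> 'rV[R]_m ;
  bwd : 'rV[R]_m -> T ;
  open_dom : open dom ;
  open_img : open (fwd @` dom) ;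
  fwdK : forall p, dom p -> bwd (fwd p) = p ;
  fwd_continuous : forall p, dom p -> {for p, continuous fwd} ;
  bwd_continuous : forall u, (fwd @` dom) u -> {for u, continuous bwd}
}.

Definition img {R : realType} {T : topologicalType} {m : nat}
  (c : chart R T m) : set 'rV[R]_m := fwd c @` dom c.

Definition smooth_transition {R : realType} {T : topologicalType} {m : nat}
    (c d : chart R T m) : Prop :=
  smooth_on (fwd c @` (dom c `&` dom d)) (fwd d \o bwd c).

(* Each point p carries a preferred chart [chart_at p] of the atlas. The tangent
   space T_pM is 'rV_m, identified through the coordinates of [chart_at p].
   Linear maps act on row vectors from the right, a bilinear form B on T_pM is
   the matrix with B(X, Y) = X *m B *m Y^T. A tensor field is thus a plain
   function of p, and its smoothness is expressed by its components in charts. *)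
Record manifold (R : realType) (m : nat) := Manifold {
  mtop :> topologicalType ;
  atlas : set (chart R mtop m) ;
  chart_at : mtop -> chart R mtop m ;
  chart_at_atlas : forall p, atlas (chart_at p) ;
  chart_at_dom : forall p, dom (chart_at p) p ;
  atlas_smooth : forall c d, atlas c -> atlas d -> smooth_transition c d ;
  manifold_hausdorff : hausdorff_space mtop ;
  manifold_second_countable : @second_countable mtop
}.
Arguments atlas {R m} _.
Arguments chart_at {R m} {_} _.

(* Components of tangent vectors and tensors in an arbitrary chart c, at
   u = fwd c p: multiplying by [to_std c u] sends the c-components of a tangent
   vector at p to its [chart_at p]-components, i.e. to the element of T_pM. *)
Definition to_std {R : realType} {m : nat} {M : manifold R m}
    (c : chart R M m) (u : 'rV[R]_m) : 'M[R]_m :=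
  'J (fwd (chart_at (bwd c u)) \o bwd c) u.

Definition bilin_in {R : realType} {m : nat} {M : manifold R m}
    (c : chart R M m) (B : M -> 'M[R]_m) (u : 'rV[R]_m) : 'M[R]_m :=
  to_std c u *m B (bwd c u) *m (to_std c u)^T.

Definition endo_in {R : realType} {m : nat} {M : manifold R m}
    (c : chart R M m) (A : M -> 'M[R]_m) (u : 'rV[R]_m) : 'M[R]_m :=
  to_std c u *m A (bwd c u) *m invmx (to_std c u).

Definition smooth_fun {R : realType} {m : nat} {M : manifold R m}
    (f : M -> R) : Prop :=
  forall c, atlas M c -> smooth_on (img c) (f \o bwd c : _ -> R^o).

Definition smooth_map {R : realType} {n m : nat}
    {N : manifold R n} {M : manifold R m} (F : N -> M) : Prop :=
  continuous F /\
  forall a b, atlas N a -> atlas M b ->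
    smooth_on [set u | img a u /\ dom b (F (bwd a u))] (fwd b \o F \o bwd a).

Definition differential {R : realType} {n m : nat}
    {N : manifold R n} {M : manifold R m} (F : N -> M) (x : N) : 'M[R]_(n, m) :=
  'J (fwd (chart_at (F x)) \o F \o bwd (chart_at x)) (fwd (chart_at x) x).

Definition immersion {R : realType} {n m : nat}
    {N : manifold R n} {M : manifold R m} (F : N -> M) : Prop :=
  smooth_map F /\ forall x, row_free (differential F x).

Definition riem_metric {R : realType} {m : nat} {M : manifold R m}
    (g : M -> 'M[R]_m) : Prop :=
  [/\ forall c, atlas M c -> smooth_on (img c) (bilin_in c g),
      forall p, (g p)^T = g p &
      forall p (v : 'rV[R]_m), v != 0 -> 0 < (v *m g p *m v^T) 0 0].

Definition conformal {R : realType} {m : nat} {M : manifold R m}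
    (a : R) (psi : M -> R) (g : M -> 'M[R]_m) : M -> 'M[R]_m :=
  fun p => expR (a * psi p) *: g p.

Definition gradient {R : realType} {m : nat} {M : manifold R m}
    (g : M -> 'M[R]_m) (f : M -> R) (p : M) : 'rV[R]_m :=
  (\row_a partial a (f \o bwd (chart_at p) : _ -> R^o) (fwd (chart_at p) p))
    *m invmx (g p).

(* The Christoffel symbol Gamma^k_ij at u of the Levi-Civita connection of the
   metric whose component matrix is G. *)
Definition christoffel {R : realType} {m : nat} (G : 'rV[R]_m -> 'M[R]_m)
    (k i j : 'I_m) (u : 'rV[R]_m) : R^o :=
  2^-1 * \sum_l invmx (G u) k l *
    (partial i (fun v => G v j l : R^o) u + partial j (fun v => G v i l : R^o) u
     - partial l (fun v => G v i j : R^o) u).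

(* The d_l-component of R(d_i, d_j) d_k, where
   R(X, Y) Z = nabla_X nabla_Y Z - nabla_Y nabla_X Z - nabla_[X,Y] Z. *)
Definition riemann {R : realType} {m : nat} (G : 'rV[R]_m -> 'M[R]_m)
    (l k i j : 'I_m) (u : 'rV[R]_m) : R :=
  partial i (christoffel G l j k) u - partial j (christoffel G l i k) u
  + \sum_p (christoffel G l i p u * christoffel G p j k u
            - christoffel G l j p u * christoffel G p i k u).

Definition ricci {R : realType} {m : nat} (G : 'rV[R]_m -> 'M[R]_m)
    (u : 'rV[R]_m) : 'M[R]_m :=
  \matrix_(j, k) \sum_i riemann G i k i j u.

(* In the coordinates (x_1, .., x_n, y_1, .., y_n) of R^(2n), d/dx_k is sent to
   d/dy_k and d/dy_k to - d/dx_k. *)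
Definition stdJ (R : realType) (n : nat) : 'M[R]_(n + n) :=
  block_mx 0 1%:M (- 1%:M) 0.

(* J is a complex structure: around every point there is a smooth chart, not
   necessarily in the chosen atlas, given by holomorphic coordinates. *)
Definition integrable_complex {R : realType} {n : nat} {M : manifold R (n + n)}
    (J : M -> 'M[R]_(n + n)) : Prop :=
  forall p, exists c : chart R M (n + n),
    [/\ dom c p,
        forall d, atlas M d -> smooth_transition c d /\ smooth_transition d c &
        forall u, img c u -> endo_in c J u = stdJ R n].

(* omega(X, Y) = g(JX, Y) *)
Definition fundamental_form {R : realType} {m : nat} {M : manifold R m}
    (J g : M -> 'M[R]_m) : M -> 'M[R]_m := fun p => J p *m g p.

Definition closed_2form {R : realType} {m : nat} {M : manifold R m}
    (w : M -> 'M[R]_m) : Prop :=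
  forall c, atlas M c -> forall u, img c u -> forall i j k,
    partial i (fun v => bilin_in c w v j k : R^o) u
    + partial j (fun v => bilin_in c w v k i : R^o) u
    + partial k (fun v => bilin_in c w v i j : R^o) u = 0.

Record kahler (R : realType) (n : nat) (M : manifold R (n + n)) := Kahler {
  cpx : M -> 'M[R]_(n + n) ;
  metric : M -> 'M[R]_(n + n) ;
  cpx_smooth : forall c, atlas M c -> smooth_on (img c) (endo_in c cpx) ;
  cpx_sqr : forall p, cpx p *m cpx p = - 1%:M ;
  cpx_integrable : integrable_complex cpx ;
  metric_riem : riem_metric metric ;
  metric_hermitian : forall p, cpx p *m metric p *m (cpx p)^T = metric p ;
  kform_closed : closed_2form (fundamental_form cpx metric)
}.

Definition kform {R : realType} {n : nat} {M : manifold R (n + n)}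
  (k : kahler M) : M -> 'M[R]_(n + n) := fundamental_form (cpx k) (metric k).

(* rho(X, Y) = Ric(JX, Y), in the chart c. *)
Definition ricci_form_in {R : realType} {n : nat} {M : manifold R (n + n)}
    (k : kahler M) (c : chart R M (n + n)) (u : 'rV[R]_(n + n)) :=
  endo_in c (cpx k) u *m ricci (bilin_in c (metric k)) u.

(* d^c psi = - d psi o J, in the chart c. *)
Definition dc_in {R : realType} {m : nat} {M : manifold R m}
    (J : M -> 'M[R]_m) (psi : M -> R) (c : chart R M m)
    (j : 'I_m) (u : 'rV[R]_m) : R^o :=
  - \sum_b endo_in c J u j b * partial b (psi \o bwd c : _ -> R^o) u.

Definition ddc_in {R : realType} {m : nat} {M : manifold R m}
    (J : M -> 'M[R]_m) (psi : M -> R) (c : chart R M m)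
    (u : 'rV[R]_m) : 'M[R]_m :=
  \matrix_(i, j) (partial i (dc_in J psi c j) u - partial j (dc_in J psi c i) u).

Definition almost_einstein {R : realType} {n : nat} {M : manifold R (n + n)}
    (k : kahler M) (lambda : R) (psi : M -> R) : Prop :=
  smooth_fun psi /\
  forall c, atlas M c -> forall u, img c u ->
    ricci_form_in k c u =
      lambda *: bilin_in c (kform k) u + n%:R *: ddc_in (cpx k) psi c u.

(* The Lebesgue integral over R^n as an iterated integral; it is only applied to
   continuous functions with compact support. *)
Fixpoint integral_rV {R : realType} {n : nat} : ('rV[R]_n -> R) -> R :=
  match n with
  | 0 => fun f => f 0
  | n'.+1 => fun f => Rintegral (@lebesgue_measure R) setT
      (fun t => integral_rV (fun v : 'rV[R]_n' => f (row_mx (t%:M : 'rV_1) v)))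
  end.

Definition partition_of_unity {R : realType} {n : nat} {N : manifold R n}
    (P : seq (chart R N n * (N -> R))) : Prop :=
  (forall i cr, onth P i = Some cr ->
    [/\ atlas N cr.1, continuous (cr.2 : N -> R^o), forall x, 0 <= cr.2 x &
        closure [set x | cr.2 x != 0] `<=` dom cr.1]) /\
  forall x, \sum_(cr <- P) cr.2 x = 1.

Lemma bump_exists {R : realType} {n : nat} (N : manifold R n) (x : N) :
  exists f : N -> R, [/\ continuous (f : N -> R^o), forall y, 0 <= f y, 0 < f x &
    closure [set y | f y != 0] `<=` dom (chart_at x)].
Proof.
set c := chart_at x; set u0 := fwd c x.
have cx : dom c x by exact: chart_at_dom.
have : nbhs u0 (fwd c @` dom c).
  by apply: open_nbhs_nbhs; split; [exact: open_img|exists x].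
move=> /nbhs_ballP [e /= e0 be].
pose r := e / 2; have r0 : 0 < r by rewrite divr_gt0.
pose B := closed_ball u0 r.
have Bimg : B `<=` fwd c @` dom c.
  move=> v; rewrite /B closed_ballE // /closed_ball_ /= => vr.
  apply: be; rewrite -ball_normE /=; apply: le_lt_trans vr _.
  by rewrite /r ltr_pdivrMr // ltr_pMr // ltr1n.
have cptB : compact B.
  apply: bounded_closed_compact; last exact: closed_ball_closed.
  exists (`|u0| + r); split; first exact: num_real.
  move=> M /ltW uM v; rewrite /B closed_ballE // /closed_ball_ /= => vr.
  apply: le_trans uM; rewrite -{1}(subKr u0 v).
  by apply: le_trans (ler_normB _ _) _; rewrite lerD2l.
pose K := bwd c @` B.
have cK : closed K.
  apply: compact_closed; first exact: manifold_hausdorff.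
  apply: continuous_compact => //.
  apply: continuous_in_subspaceT => v /set_mem /Bimg; exact: bwd_continuous.
have Kdom : K `<=` dom c.
  by move=> _ [v /Bimg [y cy <-] <-]; rewrite fwdK.
pose h (y : N) : R := Num.max 0 (r - `|u0 - fwd c y|).
pose f (y : N) : R := if `[< dom c y >] then h y else 0.
have fK y : f y != 0 -> K y.
  rewrite /f; case: asboolP => [cy|_]; last by rewrite eqxx.
  move=> hy; exists (fwd c y); last by rewrite fwdK.
  rewrite /B closed_ballE // /closed_ball_ /= leNgt; apply/negP => yr.
  move: hy; rewrite /h; apply/negP; rewrite negbK; apply/eqP/max_idPl.
  by rewrite subr_le0 ltW.
exists f; split.
- move=> y; have [cy|cy] := pselect (dom c y).
    have nf : {near y, f =1 h}.
      near=> z; rewrite /f asboolT //; near: z.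
      by apply: open_nbhs_nbhs; split; [exact: open_dom|].
    have hc : {for y, continuous (h : N -> R^o)}.
      apply: (@continuous_max R N (fun=> 0) (fun z => r - `|u0 - fwd c z|)).
        exact: cvg_cst.
      apply: cvgB; first exact: cvg_cst.
      apply: cvg_norm; apply: cvgB; first exact: cvg_cst.
      exact: fwd_continuous.
    have fy : f y = h y by rewrite /f asboolT.
    rewrite /prop_for /continuous_at fy; apply: cvg_trans hc.
    by apply: near_eq_cvg; near=> z; near: z; apply: filterS nf => z ->.
  apply: (near_cst_continuous 0).
  near=> z; apply/eqP/negPn/negP => /fK; near: z.
  apply: open_nbhs_nbhs; split; first by rewrite openC.
  by move=> /Kdom.
- by move=> y; rewrite /f; case: asboolP => // _; rewrite /h le_max lexx.
- by rewrite /f asboolT // /h subrr normr0 subr0 lt_max r0 orbT.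
- apply: subset_trans Kdom; rewrite [X in _ `<=` X](closure_id K).1 //.
  by apply: closureS => y /fK.
Unshelve. all: by end_near. Qed.

Lemma partition_exists {R : realType} {n : nat} (N : manifold R n) :
  compact [set: N] -> exists P, @partition_of_unity R n N P.
Proof.
move=> cN.
have /choice [f fP] := @bump_exists R n N.
have fc i : continuous (f i : N -> R^o) by case: (fP i).
have f0 i y : 0 <= f i y by case: (fP i).
have [[x0 _]|N0] := pselect (exists x : N, True); last first.
  by exists [::]; split=> [i cr|x]; [rewrite onth0n|case: N0; exists x].
pose T : ptopologicalType := HB.pack (mtop N) (isPointed.Build (mtop N) x0).
have : @cover_compact T [set: T] by rewrite -compact_cover.
move=> /(_ N [set: N] (fun i => [set y | 0 < f i y])) [].
- move=> i _; rewrite (_ : [set _ | _] = f i @^-1` [set t | 0 < t]) //.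
  by apply: open_comp; [move=> y _; exact: fc|exact: open_gt].
- by move=> y _; exists y => //; case: (fP y).
move=> D' _ covD'.
pose D : seq N := finmap.enum_fset D'.
have covD y : exists2 i, i \in D & 0 < f i y.
  by have [i /= iD fiy] := covD' y I; exists i.
pose S y := \sum_(i <- D) f i y.
have S0 y : 0 < S y.
  have [i iD fiy] := covD y.
  rewrite /S (big_rem i) //=; apply: ltr_pwDl => //.
  by apply: sumr_ge0 => j _.
have Sc : continuous (S : N -> R^o).
  by apply: (@continuous_big R^o _ +%R _ predT) => //; exact: add_continuous.
exists [seq (chart_at i, fun y => f i y / S y) | i <- D]; split.
  move=> i cr; rewrite onth_map; case: onth => //= j [<-]; split => /=.
  - exact: chart_at_atlas.
  - move=> y; apply: cvgM; first exact: fc.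
    by apply: cvgV; [rewrite gt_eqF|exact: Sc].
  - by move=> y; rewrite divr_ge0 // ltW.
  - have [_ _ _] := fP j; apply: subset_trans.
    by apply: closureS => y /=; apply: contra_neq => ->; rewrite mul0r.
move=> y; rewrite big_map /= -mulr_suml divff // gt_eqF //.
exact: S0.
Qed.

Definition chosen_partition {R : realType} {n : nat} (N : manifold R n) :
    seq (chart R N n * (N -> R)) :=
  if pselect (exists P, @partition_of_unity R n N P) is left e
  then projT1 (cid e) else [::].

Lemma chosen_partitionP {R : realType} {n : nat} (N : manifold R n) :
  compact [set: N] -> partition_of_unity (chosen_partition N).
Proof.
move=> /partition_exists eP; rewrite /chosen_partition.
by case: pselect => // e; case: cid.
Qed.

(* The integral of f against the volume measure of the metric h; by the change
   of variables formula it does not depend on the partition of unity. *)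
Definition riem_integral {R : realType} {n : nat} {N : manifold R n}
    (h : N -> 'M[R]_n) (f : N -> R) : R :=
  \sum_(cr <- chosen_partition N)
    integral_rV ((fun u => cr.2 (bwd cr.1 u) * f (bwd cr.1 u)
                           * Num.sqrt (\det (bilin_in cr.1 h u))) \_ (img cr.1)).

Definition pullback {R : realType} {n m : nat} {N : manifold R n}
    {M : manifold R m} (F : N -> M) (g : M -> 'M[R]_m) : N -> 'M[R]_n :=
  fun x => differential F x *m g (F x) *m (differential F x)^T.

Definition volume {R : realType} {n m : nat} {N : manifold R n}
    {M : manifold R m} (g : M -> 'M[R]_m) (F : N -> M) : R :=
  riem_integral (pullback F g) (fun=> 1).

Definition L2_metric {R : realType} {n m : nat} {N : manifold R n}
    {M : manifold R m} (g : M -> 'M[R]_m) (F : N -> M)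
    (Y Z : N -> 'rV[R]_m) : R :=
  riem_integral (pullback F g) (fun x => (Y x *m g (F x) *m (Z x)^T) 0 0).

(* g-orthogonal projection of T_F(x)M onto the normal space of F at x. *)
Definition normal_proj {R : realType} {n m : nat} {N : manifold R n}
    {M : manifold R m} (g : M -> 'M[R]_m) (F : N -> M) (x : N)
    (v : 'rV[R]_m) : 'rV[R]_m :=
  let E := differential F x in
  v - v *m g (F x) *m E^T *m invmx (pullback F g x) *m E.

(* nabla_{dF(d_i)} dF(d_j) at x, in the preferred charts at x and F x. *)
Definition nabla_dF {R : realType} {n m : nat} {N : manifold R n}
    {M : manifold R m} (g : M -> 'M[R]_m) (F : N -> M) (x : N)
    (i j : 'I_n) : 'rV[R]_m :=
  let a := chart_at x in
  let b := chart_at (F x) in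
  let E := differential F x in
  partial i (partial j (fwd b \o F \o bwd a)) (fwd a x)
  + \row_k \sum_p \sum_q
      christoffel (bilin_in b g) k p q (fwd b (F x)) * E i p * E j q.

Definition second_fundamental_form {R : realType} {n m : nat}
    {N : manifold R n} {M : manifold R m} (g : M -> 'M[R]_m) (F : N -> M)
    (x : N) (i j : 'I_n) : 'rV[R]_m :=
  normal_proj g F x (nabla_dF g F x i j).

Definition mean_curvature {R : realType} {n m : nat}
    {N : manifold R n} {M : manifold R m} (g : M -> 'M[R]_m) (F : N -> M)
    (x : N) : 'rV[R]_m :=
  \sum_i \sum_j invmx (pullback F g x) i j *: second_fundamental_form g F x i j.

Definition generalized_mean_curvature {R : realType} {n m : nat}
    {N : manifold R n} {M : manifold R m} (g : M -> 'M[R]_m) (psi : M -> R)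
    (F : N -> M) (x : N) : 'rV[R]_m :=
  mean_curvature g F x - n%:R *: normal_proj g F x (gradient g psi (F x)).

Definition normal_field {R : realType} {n m : nat} {N : manifold R n}
    {M : manifold R m} (g : M -> 'M[R]_m) (F : N -> M)
    (Y : N -> 'rV[R]_m) : Prop :=
  (forall a b, atlas N a -> atlas M b ->
     smooth_on [set u | img a u /\ dom b (F (bwd a u))]
       (fun u => Y (bwd a u) *m invmx (to_std b (fwd b (F (bwd a u)))))) /\
  forall x, Y x *m g (F x) *m (differential F x)^T = 0.

(* Fs is a smooth family of immersions, defined for |s| < eps, with initial
   immersion F and initial velocity Y. *)
Definition smooth_variation {R : realType} {n m : nat} {N : manifold R n}
    {M : manifold R m} (F : N -> M) (Y : N -> 'rV[R]_m)
    (eps : R) (Fs : R -> N -> M) : Prop :=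
  [/\ (forall s x, `|s| < eps ->
         {for (s, x), continuous (fun z : R * N => Fs z.1 z.2)}),
      (forall a b, atlas N a -> atlas M b ->
         smooth_on [set z : R^o * 'rV[R]_n |
                     [/\ `|z.1| < eps, img a z.2 & dom b (Fs z.1 (bwd a z.2))]]
           (fun z => fwd b (Fs z.1 (bwd a z.2)))),
      (forall s, `|s| < eps -> immersion (Fs s)),
      Fs 0 = F &
      forall x, is_derive (0 : R^o) 1 (fun s => fwd (chart_at (F x)) (Fs s x)) (Y x)].

(* Main.v *)
Require Import Defs.
From mathcomp Require Import all_boot all_order all_algebra.
From mathcomp Require Import all_classical all_reals all_analysis.
From mathcomp Require Import perm ring.
Set Implicit Arguments.
Unset Strict Implicit.
Unset Printing Implicit Defensive.
Import Order.TTheory GRing.Theory Num.Theory.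
Import numFieldNormedType.Exports.
Local Open Scope classical_set_scope.
Local Open Scope ring_scope.

(** Both sides of the identity are integrals over [N], and the integrands agree
    at every point.  Write [f_i] for the coordinate tangent vectors of [N] in a
    chart, [h_ij = g(f_i, f_j)] for the metric induced by the Kaehler metric
    [g], and [D] for the Levi-Civita connection.  Since [Y] is normal along
    [N], differentiating [g(Y, f_j) = 0] along [N] gives
    [g(D_i Y, f_j) = - g(Y, D_i f_j)], and since the time derivative commutes
    with the space derivatives, [h_ij] has time derivative
    [g(D_i Y, f_j) + g(f_i, D_j Y) = - g(Y, D_i f_j) - g(Y, D_j f_i)]
    ([first_variation_metric]).  By Jacobi's formula for the determinant the
    density [sqrt(det h)] then has derivative [- g(H, Y) sqrt(det h)].  No
    divergence of a tangential field appears, so nothing has to be integrated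
    by parts.

    The metric [exp(2 psi) g] has density [exp(n psi) sqrt(det h)], whose
    derivative is [exp(n psi) (n dpsi(Y) - g(H, Y)) sqrt(det h)], that is
    [- exp(n psi) g(K, Y) sqrt(det h)].  For the metric [exp(a psi) g] the
    product of [Y] with [K] contributes the factor [exp(a psi)] and the density
    the factor [exp(a n / 2 psi)]; together they give [exp(n psi)] precisely
    when [a (1 + n / 2) = n], that is [a = 2 n / (n + 2)].

    For the exchange of derivative and integral, the notion [slope] is
    a Caratheodory form of the time derivative that is uniform in the space
    variable near a point.  It is stable under the operations that build a
    volume density ([slopeM], [slope_det], [slope_sqrt]), it holds for functions
    with a continuous time derivative by the mean value theorem ([slope_C1]),
    and compactness of the support makes it globally uniform, which is enough to
    differentiate an iterated integral ([integral_rV_derive]).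

    Tensors on a manifold are given at each point in the preferred chart of that
    point, and this chart jumps from point to point.  The pulled-back metric is
    therefore first rewritten in a fixed pair of charts ([bilin_in_pullback]),
    where it depends smoothly on time and space ([slope_density_chart]).  The
    value of the derivative is computed in the preferred chart
    ([slope_density_chart_at]); passing to another chart multiplies the density
    by a factor constant in time ([slope_density]). *)

(** * Iterated integrals of continuous functions with compact support *)

Lemma cvg_mx (R : realType) (T : Type) (F : set_system T) (FF : Filter F)
    (m n : nat) (f : T -> 'M[R]_(m, n)) (A : 'M[R]_(m, n)) :
  (forall i j, f x i j @[x --> F] --> A i j) -> f @ F --> A.
Proof.
move=> fA B [P AP sPB]; apply: (filterS sPB) => /=.
apply: filter_forall => i; apply: filter_forall => j.
exact: (fA i j _ (AP i j)).
Qed.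

Lemma pairr_continuous (T U : topologicalType) (t : T) :
  continuous (fun v : U => (t, v)).
Proof. by move=> v; apply: cvg_pair => /=; [exact: cvg_cst|exact: cvg_id]. Qed.

Lemma continuous_cst_at (T U : topologicalType) (a : U) (u : T) :
  {for u, continuous (fun=> a)}.
Proof. exact: cvg_cst. Qed.

Section integral_rV.
Variable R : realType.

Definition compactly_supported {n} (r : R) (f : 'rV[R]_n -> R) :=
  continuous f /\ forall u, r < `|u| -> f u = 0.

Lemma compactly_supported_lin n r (f g : 'rV[R]_n -> R) a :
  compactly_supported r f -> compactly_supported r g ->
  compactly_supported r (fun u => a * f u + g u).
Proof.
move=> [cf sf] [cg sg]; split=> [u /=|u ru]; last by rewrite sf // sg // mulr0 addr0.
exact: cvgD (cvgMl_tmp (cf u)) (cg u).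
Qed.

Lemma continuous_segment_integrable (r : R) (f : R -> R) : continuous f ->
  (@lebesgue_measure R).-integrable `[-r, r] (EFin \o f).
Proof.
move=> cf; have := @continuous_compact_integrable R f `[-r, r]%classic.
apply; [exact: segment_compact|exact: continuous_subspaceT].
Qed.

Lemma continuous_support_integrable (r : R) (f : R -> R) :
  continuous f -> (forall t, r < `|t| -> f t = 0) ->
  (@lebesgue_measure R).-integrable setT (EFin \o f).
Proof.
move=> cf sf; have := continuous_segment_integrable r cf.
rewrite integrable_mkcond //; apply: eq_integrable => // t _.
rewrite patchE; case: ifPn => // /negP.
rewrite inE /= in_itv /= -ler_norml => /negP; rewrite -ltNge => /sf.
by rewrite /comp => ->.
Qed.

Lemma RintegralT_bound r m (f : R -> R) : 0 <= r ->
  continuous f -> (forall t, r < `|t| -> f t = 0) -> (forall t, `|f t| <= m) ->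
  `|Rintegral (@lebesgue_measure R) setT f| <= 2 * r * m.
Proof.
move=> r0 cf sf fm.
have -> : Rintegral (@lebesgue_measure R) setT f =
    Rintegral (@lebesgue_measure R) `[-r, r] f.
  rewrite [RHS]Rintegral_mkcond; apply: eq_Rintegral => t _.
  rewrite patchE; case: ifPn => // /negP.
  by rewrite inE /= in_itv /= -ler_norml => /negP; rewrite -ltNge => /sf.
have intf := @continuous_segment_integrable r.
apply: le_trans (le_normr_Rintegral _ _) _ => //; first exact: intf.
apply: (@le_trans _ _ (Rintegral (@lebesgue_measure R) `[-r, r] (fun=> m))).
  apply: le_Rintegral => //.
  - by apply: intf => t; apply: cvg_norm; exact: cf.
  - by apply: (intf (cst m)) => t; exact: cvg_cst.
rewrite Rintegral_cst //= lebesgue_measure_itv /= lte_fin.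
case: ltP => rr /=; first by rewrite le_eqVlt; apply/orP; left; apply/eqP; ring.
have m0 : 0 <= m by apply: le_trans (fm 0).
by rewrite mulr0 !mulr_ge0.
Qed.

Lemma norm_row_mx n (t : R) (v : 'rV[R]_n) :
  `|t| <= `|row_mx (t%:M : 'rV_1) v : 'rV_(1 + n)| /\
  `|v| <= `|row_mx (t%:M : 'rV_1) v : 'rV_(1 + n)|.
Proof.
set w := row_mx _ _.
have lew j : `|w 0 j| <= `|w|.
  by rewrite [leRHS]/Num.norm /= mx_normrE; exact: (le_bigmax _ _ (0, j)).
split; first by have := lew (lshift n 0); rewrite row_mxEl mxE eqxx mulr1n.
rewrite [leLHS]/Num.norm /= mx_normrE; apply/bigmax_leP; split => //.
move=> -[i j] _ /=; rewrite (ord1 i).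
by have := lew (rshift 1 j); rewrite row_mxEr.
Qed.

Lemma row_mx_continuous n :
  continuous (fun z : R * 'rV[R]_n => row_mx (z.1%:M : 'rV_1) z.2 : 'rV_(1 + n)).
Proof.
move=> z; apply: cvg_mx => i j.
case: (split_ordP j) => k ->.
  under eq_fun do rewrite row_mxEl mxE.
  rewrite row_mxEl mxE.
  by rewrite !(ord1 i) !(ord1 k) eqxx !mulr1n; exact: cvg_fst.
under eq_fun do rewrite row_mxEr.
rewrite row_mxEr (ord1 i).
apply: (@cvg_comp _ _ _ snd (fun v : 'rV_n => v 0 k) _ (nbhs z.2)).
  exact: cvg_snd.
exact: coord_continuous.
Qed.

(** The integrand of the inner integral in the recursive definition of
    [integral_rV]. *)
Definition slice n (f : 'rV[R]_n.+1 -> R) (t : R) : 'rV[R]_n -> R :=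
  fun v => f (row_mx (t%:M : 'rV_1) v).

Lemma slice_continuous n (f : 'rV[R]_n.+1 -> R) :
  continuous f -> continuous (fun z : R * 'rV[R]_n => slice f z.1 z.2).
Proof.
move=> cf z; apply: (@continuous_comp _ _ _ (fun z : R * 'rV[R]_n =>
  row_mx (z.1%:M : 'rV_1) z.2 : 'rV_(1 + n)) f).
  exact: row_mx_continuous.
exact: cf.
Qed.

Lemma slice_supported n r (f : 'rV[R]_n.+1 -> R) t :
  compactly_supported r f -> compactly_supported r (slice f t).
Proof.
move=> [cf sf]; split=> [v|v rv].
  apply: (@continuous_comp _ _ _ (fun v : 'rV[R]_n => (t, v))
    (fun z : R * 'rV[R]_n => slice f z.1 z.2)).
    exact: pairr_continuous.
  exact: slice_continuous.
by apply: sf; apply: lt_le_trans rv _; case: (norm_row_mx t v).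
Qed.

Lemma closed_ball_compact n (r : R) : compact [set v : 'rV[R]_n | `|v| <= r].
Proof.
apply: bounded_closed_compact.
  by exists r; split; [exact: num_real|move=> M /ltW rM v /= /le_trans; exact].
rewrite (_ : mkset _ = (fun v : 'rV[R]_n => `|v|) @^-1` [set t | t <= r]) //.
apply: closed_comp; last exact: closed_le.
by move=> v _; exact: norm_continuous.
Qed.

(** Uniform continuity of [f] in its first variable: pointwise continuity on
    the compact ball that carries the slices is made uniform by a covering
    argument. *)
Lemma slice_uniform n r (f : 'rV[R]_n.+1 -> R) t e : 0 < e ->
  compactly_supported r f ->
  \forall t' \near t, forall v, `|slice f t' v - slice f t v| <= e.
Proof.
move=> e0 [cf sf].
have /compact_near_coveringP /(_ _ (nbhs t)
  (fun t' v => `|slice f t' v - slice f t v| <= e) _) := @closed_ball_compact n r.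
move=> /(_ _) near_t.
have {}near_t : \forall t' \near t, [set v : 'rV[R]_n | `|v| <= r] `<=`
    [set v | `|slice f t' v - slice f t v| <= e].
  apply: near_t => v _.
  have e2 : 0 < e / 2 by rewrite divr_gt0.
  have c1 := @slice_continuous _ f cf (t, v).
  have /cvgrPdist_lt/(_ _ e2) := c1.
  move=> /= [[A B]] /= [At Bv] AB.
  exists (B, A) => //= -[v' t'] /= [Bv' At'].
  have h1 := AB (t', v') (conj At' Bv').
  have h2 := AB (t, v') (conj (nbhs_singleton At) Bv').
  rewrite /= in h1 h2; rewrite -(subrKA (slice f t v)) (splitr e).
  apply: le_trans (ler_normD _ _) _; rewrite lerD // ltW //.
  by rewrite distrC.
apply: filterS near_t => t' h v.
have [|rv] := leP `|v| r; first exact: h.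
have s0 s : slice f s v = 0.
  by apply: sf; apply: lt_le_trans rv _; case: (norm_row_mx s v).
by rewrite !s0 subrr normr0 ltW.
Qed.

Lemma integral_rVS n (f : 'rV[R]_n.+1 -> R) :
  integral_rV f = Rintegral (@lebesgue_measure R) setT
    (fun t => integral_rV (slice f t)).
Proof. by []. Qed.

(** Linearity and the bound by the volume of a cube are proved together by
    induction on the dimension: both are used, one dimension lower, to see that
    the inner integral is again a continuous function with compact support. *)
Lemma integral_rV_lin_bound n r : 0 <= r ->
  (forall a (f g : 'rV[R]_n -> R),
    compactly_supported r f -> compactly_supported r g ->
    integral_rV (fun u => a * f u + g u) = a * integral_rV f + integral_rV g) /\
  (forall m (f : 'rV[R]_n -> R),
    compactly_supported r f -> (forall u, `|f u| <= m) ->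
    `|integral_rV f| <= (2 * r) ^+ n * m).
Proof.
move=> r0; elim: n => [|n [lin bound]].
  by split=> // m f _ fm /=; rewrite expr0 mul1r.
have inner f : compactly_supported r f ->
    continuous (fun t => integral_rV (slice f t)) /\
    forall t, r < `|t| -> integral_rV (@slice n f t) = 0.
  move=> Cf; split=> [t|t rt].
    apply/cvgrPdist_le => e e0.
    (* the summand 1 keeps C positive when r = 0 *)
    pose C := (2 * r) ^+ n + 1.
    have C0 : 0 < C by rewrite ltr_wpDl // exprn_ge0 // mulr_ge0.
    have eC : 0 < e / C by rewrite divr_gt0.
    apply: filterS (slice_uniform t eC Cf) => t' ht'.
    have Ct s := @slice_supported n r f s Cf.
    have -> : integral_rV (slice f t) - integral_rV (slice f t') =
      integral_rV (fun v => (-1) * slice f t' v + slice f t v).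
      by rewrite lin //; ring.
    apply: le_trans (bound (e / C) _ (compactly_supported_lin _ (Ct t') (Ct t)) _) _.
      by move=> v; rewrite mulN1r addrC distrC; exact: ht'.
    rewrite mulrCA; apply: ler_piMr; first exact: ltW.
    by rewrite ler_pdivrMr // mul1r /C lerDl.
  have s0 : slice f t = fun v => (-1) * slice f t v + slice f t v.
    apply/funext => v; rewrite (_ : slice f t v = 0) ?mulr0 ?addr0 //.
    by case: Cf => _; apply; apply: lt_le_trans rt _; case: (norm_row_mx t v).
  rewrite s0 lin; first by ring.
    exact: slice_supported.
  exact: slice_supported.
split=> [a f g Cf Cg|m f Cf fm].
  have [cf sf] := inner f Cf; have [cg sg] := inner g Cg.
  have intf := continuous_support_integrable cf sf.
  have intg := continuous_support_integrable cg sg.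
  rewrite !integral_rVS -RintegralZl // -RintegralD //.
    apply: eq_Rintegral => t _.
    by rewrite -lin //; exact: slice_supported.
  rewrite (_ : _ \o _ = (fun t => (a%:E * (integral_rV (slice f t))%:E)%E)) //.
  exact: integrableZl.
have [cf sf] := inner f Cf.
rewrite integral_rVS exprS -mulrA.
apply: RintegralT_bound => // t.
by apply: bound => [|v]; [exact: slice_supported|exact: fm].
Qed.

Lemma integral_rV_lin n r a (f g : 'rV[R]_n -> R) : 0 <= r ->
  compactly_supported r f -> compactly_supported r g ->
  integral_rV (fun u => a * f u + g u) = a * integral_rV f + integral_rV g.
Proof. by move=> r0; case: (integral_rV_lin_bound n r0) => + _; exact. Qed.

Lemma integral_rVN n r (f : 'rV[R]_n -> R) : 0 <= r ->
  compactly_supported r f -> integral_rV (fun u => - f u) = - integral_rV f.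
Proof.
move=> r0 Cf.
have C0 : compactly_supported r (fun _ : 'rV[R]_n => 0 : R).
  by split=> // u; exact: (@continuous_cst_at _ R).
have I0 : integral_rV (fun _ : 'rV[R]_n => 0 : R) = 0.
  have := integral_rV_lin 1 r0 C0 C0.
  under [X in integral_rV X = _]eq_fun do rewrite mulr0 addr0.
  by move=> /eqP; rewrite mul1r -subr_eq subrr => /eqP.
have := integral_rV_lin (-1) r0 Cf C0.
under [X in integral_rV X = _]eq_fun do rewrite mulN1r addr0.
by rewrite I0 mulN1r addr0.
Qed.

Lemma integral_rV_bound n r m (f : 'rV[R]_n -> R) : 0 <= r ->
  compactly_supported r f -> (forall u, `|f u| <= m) ->
  `|integral_rV f| <= (2 * r) ^+ n * m.
Proof. by move=> r0; case: (integral_rV_lin_bound n r0) => _; exact. Qed.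

End integral_rV.

(** * Locally uniform time derivatives *)

Section slope.
Variables (R : realType) (U : topologicalType).
Implicit Types (w : R -> U -> R) (u : U).

(** Caratheodory's definition of a derivative, for the time derivative at [0]
    of a function of time and space: the quotient [q] converges to [d] jointly
    in both variables, hence uniformly in space near [u0].  In this form the
    rules of calculus are identities between quotients. *)
Definition slope w u0 (d : R) := exists q : R * U -> R,
  [/\ q z @[z --> (0 : R, u0)] --> d,
      \forall z \near (0 : R, u0), w z.1 z.2 = w 0 z.2 + z.1 * q z &
      {for u0, continuous (w 0)}].

Lemma near_snd0 u0 (P : set (R * U)) :
  (\forall z \near (0 : R, u0), P z) -> \forall u \near u0, P (0, u).
Proof.
move=> [[A B]] /= [A0 Bu] AB; apply: filterS Bu => u Bu.
by apply: AB; split => //; exact: nbhs_singleton.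
Qed.

Lemma near_filterS2 u0 (P Q S : set (R * U)) : (forall z, P z -> Q z -> S z) ->
  (\forall z \near (0 : R, u0), P z) -> (\forall z \near (0 : R, u0), Q z) ->
  \forall z \near (0 : R, u0), S z.
Proof. by move=> PQS; apply: (@filterS2 _ (nbhs (0 : R, u0))). Qed.

Lemma near_snd u0 (P : set U) :
  (\forall u \near u0, P u) -> \forall z \near (0 : R, u0), P z.2.
Proof.
move=> Pu; exists (setT, P) => /=; first by split => //; exact: filterT.
by move=> z [].
Qed.

Lemma near_fst u0 (P : set (R * U)) :
  (\forall z \near (0 : R, u0), P z) -> \forall s \near (0 : R), P (s, u0).
Proof.
move=> [[A B]] /= [A0 Bu] AB; apply: filterS A0 => s As.
by apply: AB; split => //; exact: nbhs_singleton.
Qed.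

Lemma continuous_snd u0 (g : U -> R) : {for u0, continuous g} ->
  g z.2 @[z --> (0 : R, u0)] --> g u0.
Proof. by move=> cg; apply: (@cvg_comp _ _ _ snd g _ (nbhs u0)) cg; exact: cvg_snd. Qed.

Lemma slope_cvg w u0 d : slope w u0 d -> w z.1 z.2 @[z --> (0 : R, u0)] --> w 0 u0.
Proof.
move=> [q [qd wq c0]].
have : w 0 z.2 + z.1 * q z @[z --> (0 : R, u0)] --> w 0 u0 + 0 * d.
  apply: cvgD; first exact: continuous_snd.
  by apply: cvgM; [exact: cvg_fst|].
rewrite mul0r addr0; apply: cvg_trans; apply: near_eq_cvg.
by apply: filterS wq => z.
Qed.

Lemma slope_near w1 w2 u0 d :
  (\forall z \near (0 : R, u0), w1 z.1 z.2 = w2 z.1 z.2) ->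
  slope w1 u0 d -> slope w2 u0 d.
Proof.
move=> w12 [q [qd wq c0]]; exists q; split => //.
  have w0 : \forall z \near (0 : R, u0), w1 0 z.2 = w2 0 z.2.
    exact: near_snd (near_snd0 w12).
  near=> z.
  have h1 : w1 z.1 z.2 = w2 z.1 z.2 by near: z.
  have h2 : w1 0 z.2 = w2 0 z.2 by near: z.
  by rewrite -h1 -h2; near: z.
have n0 := near_snd0 w12; rewrite /= in n0.
rewrite /prop_for /continuous_at -(nbhs_singleton n0).
by apply: cvg_trans c0; apply: near_eq_cvg; apply: filterS n0 => z ->.
Unshelve. all: by end_near. Qed.

Lemma slope_cst (g : U -> R) u0 : {for u0, continuous g} -> slope (fun=> g) u0 0.
Proof.
move=> cg; exists (fun=> 0); split => //; first exact: cvg_cst.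
by near=> z; rewrite mulr0 addr0.
Unshelve. all: by end_near. Qed.

Lemma slopeD w1 w2 u0 d1 d2 : slope w1 u0 d1 -> slope w2 u0 d2 ->
  slope (fun s u => w1 s u + w2 s u) u0 (d1 + d2).
Proof.
move=> [q1 [qd1 wq1 c1]] [q2 [qd2 wq2 c2]].
exists (fun z => q1 z + q2 z); split.
- exact: cvgD qd1 qd2.
- by apply: near_filterS2 wq1 wq2 => z -> ->; ring.
- exact: cvgD c1 c2.
Qed.

Lemma slopeM w1 w2 u0 d1 d2 : slope w1 u0 d1 -> slope w2 u0 d2 ->
  slope (fun s u => w1 s u * w2 s u) u0 (d1 * w2 0 u0 + w1 0 u0 * d2).
Proof.
move=> s1 s2; have l1 := slope_cvg s1.
case: s1 s2 => [q1 [qd1 wq1 c1]] [q2 [qd2 wq2 c2]].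
exists (fun z => q1 z * w2 0 z.2 + w1 z.1 z.2 * q2 z); split.
- apply: cvgD (cvgM qd1 _) (cvgM l1 qd2); exact: continuous_snd.
- by apply: near_filterS2 wq1 wq2 => z h1 h2; rewrite h2 h1; ring.
- exact: cvgM c1 c2.
Qed.

Lemma slopeZ (a : R) w u0 d : slope w u0 d -> slope (fun s u => a * w s u) u0 (a * d).
Proof.
move=> sw; rewrite -[a * d]add0r -(mul0r (w 0 u0)).
apply: (@slopeM (fun _ _ => a)) => //.
by apply: (@slope_cst (fun=> a)); exact: cvg_cst.
Qed.

Lemma slope_sum (I : Type) (r : seq I) (P : pred I) (w : I -> R -> U -> R) u0
    (d : I -> R) : (forall i, slope (w i) u0 (d i)) ->
  slope (fun s u => \sum_(i <- r | P i) w i s u) u0 (\sum_(i <- r | P i) d i).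
Proof.
move=> sw; elim: r => [|i r IH].
  rewrite big_nil; under [X in slope X]eq_fun do under eq_fun do rewrite big_nil.
  by apply: (@slope_cst (fun=> 0)); exact: cvg_cst.
rewrite big_cons; under [X in slope X]eq_fun do under eq_fun do rewrite big_cons.
by case: (P i) => //; exact: slopeD.
Qed.

Lemma slope_prod (I : eqType) (r : seq I) (w : I -> R -> U -> R) u0
    (d : I -> R) : uniq r -> (forall i, slope (w i) u0 (d i)) ->
  slope (fun s u => \prod_(i <- r) w i s u) u0
    (\sum_(i <- r) d i * \prod_(j <- r | j != i) w j 0 u0).
Proof.
move=> + sw; elim: r => [_|i r IH /= /andP[ir /IH{}IH]].
  rewrite big_nil; under [X in slope X]eq_fun do under eq_fun do rewrite big_nil.
  by apply: (@slope_cst (fun=> 1)); exact: cvg_cst.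
under [X in slope X]eq_fun do under eq_fun do rewrite big_cons.
rewrite big_cons big_cons eqxx /=.
have -> : \prod_(j <- r | j != i) w j 0 u0 = \prod_(j <- r) w j 0 u0.
  rewrite big_seq_cond [RHS]big_seq; apply: eq_bigl => j.
  by rewrite andb_idr // => jr; apply: contraNneq ir => <-.
have -> : \sum_(k <- r) d k * \prod_(j <- i :: r | j != k) w j 0 u0 =
    w i 0 u0 * \sum_(k <- r) d k * \prod_(j <- r | j != k) w j 0 u0.
  rewrite mulr_sumr big_seq [RHS]big_seq; apply: eq_bigr => k kr.
  have ik : i != k by apply: contraNneq ir => ->.
  by rewrite big_cons ik mulrCA.
exact: slopeM.
Qed.

(** Jacobi's formula for the derivative of the determinant, in algebraic form:
    differentiating the Leibniz sum amounts to replacing one row of [A] at a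
    time by the corresponding row of [D]. *)
Lemma det_derivativeE n (A D : 'M[R]_n) :
  \sum_(s : 'S_n) (-1) ^+ s *
    (\sum_i D i (s i) * \prod_(j | j != i) A j (s j)) =
  \sum_i \sum_j D i j * cofactor A i j.
Proof.
under eq_bigr do rewrite mulr_sumr.
rewrite exchange_big /=; apply: eq_bigr => i _.
pose B := \matrix_(k, l) if k == i then D k l else A k l.
transitivity (\det B).
  apply: eq_bigr => s _; congr (_ * _).
  rewrite [RHS](bigD1 i) //= mxE eqxx; congr (_ * _).
  by apply: eq_bigr => j /negPf ji; rewrite mxE ji.
rewrite (expand_det_row B i); apply: eq_bigr => j _.
rewrite mxE eqxx /cofactor; congr (_ * (_ * \det _)).
apply/matrixP => k l; rewrite !mxE.
by rewrite eq_sym (negPf (neq_lift _ _)).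
Qed.

Lemma slope_det n (A : R -> U -> 'M[R]_n) u0 (D : 'M[R]_n) :
  (forall i j, slope (fun s u => A s u i j) u0 (D i j)) ->
  slope (fun s u => \det (A s u)) u0
    (\sum_i \sum_j D i j * cofactor (A 0 u0) i j).
Proof.
move=> sA; rewrite -det_derivativeE /determinant.
apply: slope_sum => s; apply: slopeZ.
apply: (slope_prod (index_enum_uniq _) (w := fun i t u => A t u i (s i))
  (d := fun i => D i (s i))) => i; exact: sA.
Qed.

(** The quotient is obtained by rationalizing a difference of square roots. *)
Lemma slope_sqrt w u0 d : slope w u0 d -> 0 < w 0 u0 ->
  slope (fun s u => Num.sqrt (w s u)) u0 (d / (2 * Num.sqrt (w 0 u0))).
Proof.
move=> sw w0; have lw := slope_cvg sw.
case: sw => q [qd wq c0].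
have cs : Num.sqrt (w z.1 z.2) @[z --> (0 : R, u0)] --> Num.sqrt (w 0 u0).
  exact: continuous_cvg (@sqrt_continuous _ _) lw.
have cs0 : Num.sqrt (w 0 z.2) @[z --> (0 : R, u0)] --> Num.sqrt (w 0 u0).
  apply: continuous_cvg (@sqrt_continuous _ _) _; exact: continuous_snd.
have lpos : \forall z \near (0 : R, u0), 0 < w z.1 z.2 by exact: (cvgr_gt _ lw).
have lpos0 : \forall z \near (0 : R, u0), 0 < w 0 z.2.
  by apply: (cvgr_gt _ (continuous_snd c0)).
exists (fun z => q z / (Num.sqrt (w z.1 z.2) + Num.sqrt (w 0 z.2))); split.
- apply: cvgM qd _; apply: cvgV; first by rewrite gt_eqF // mulr_gt0 // sqrtr_gt0.
  rewrite mulr_natl mulr2n; exact: cvgD cs cs0.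
- apply: near_filterS2 wq (filterI lpos lpos0) => z wqz [p1 p2].
  have e : w z.1 z.2 - w 0 z.2 = z.1 * q z by rewrite wqz; ring.
  have s0 : Num.sqrt (w z.1 z.2) + Num.sqrt (w 0 z.2) != 0.
    by rewrite gt_eqF // addr_gt0 // sqrtr_gt0.
  apply: (mulIf s0); rewrite mulrDl -mulrA divfK // -e.
  have -> : w z.1 z.2 - w 0 z.2 =
      Num.sqrt (w z.1 z.2) ^+ 2 - Num.sqrt (w 0 z.2) ^+ 2.
    by rewrite !sqr_sqrtr ?ltW.
  by ring.
- apply: continuous_cvg (@sqrt_continuous _ _) _; exact: c0.
Qed.

Lemma is_derive0P (I : R -> R) (d : R) :
  (forall e, 0 < e -> \forall s \near (0 : R), `|I s - I 0 - s * d| <= e * `|s|) ->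
  is_derive (0 : R^o) 1 (I : R^o -> R^o) d.
Proof.
move=> Id.
have cd : h^-1 *: ((I \o shift 0) (h *: (1 : R^o)) - I 0) @[h --> 0^'] --> (d : R^o).
  apply/cvgrPdist_le => e e0.
  have Ide := @nbhs_dnbhs _ (0 : R) _ (Id e e0).
  near=> s.
  have s0 : s != 0 by near: s; exact: nbhs_dnbhs_neq.
  have : `|I s - I 0 - s * d| <= e * `|s| by near: s.
  rewrite /= /shift addr0 /GRing.scale /= mulr1.
  rewrite -ler_pdivrMr ?normr_gt0 // -normfV -normrM distrC.
  by congr (`|_| <= _); field.
apply: DeriveDef; last exact: cvg_lim cd.
by apply/cvg_ex; exists d.
Unshelve. all: by end_near. Qed.

Lemma slope_is_derive w u0 d : slope w u0 d ->
  is_derive (0 : R^o) 1 (fun s : R^o => w s u0 : R^o) d.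
Proof.
move=> [q [qd wq _]]; apply: is_derive0P => e e0.
have n1 := near_fst wq; rewrite /= in n1.
have /cvgrPdist_le /(_ _ e0) /near_fst /= n2 := qd.
apply: filterS2 n1 n2 => s -> h.
rewrite [w 0 u0 + _]addrC addrK -mulrBr normrM mulrC ler_wpM2r //.
by rewrite distrC.
Qed.

End slope.

Section continuity_of_slope.
Variables (R : realType) (U : topologicalType) (phi : R -> U -> R) (d : U -> R).
Hypothesis sphi : forall u, slope phi u (d u).

Lemma slope_local u0 e : 0 < e ->
  \forall z \near (0 : R, u0),
    `|phi z.1 z.2 - phi 0 z.2 - z.1 * d u0| <= e * `|z.1|.
Proof.
move=> e0; have [q [qd wq _]] := sphi u0.
have /cvgrPdist_le /(_ _ e0) /= n2 := qd.
apply: near_filterS2 wq n2 => z -> h.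
rewrite [phi 0 z.2 + _]addrC addrK -mulrBr normrM mulrC ler_wpM2r //.
by rewrite distrC.
Qed.

(** Continuity of the derivative comes for free: near [u0] the difference
    quotients at [u] approximate both [d u] and [d u0]. *)
Lemma slope_continuous : continuous d.
Proof.
move=> u0; apply/cvgrPdist_le => e e0.
have e2 : 0 < e / 2 by rewrite divr_gt0.
have [[A B] /= [A0 Bu] AB] := slope_local u0 e2.
apply: filterS Bu => u Bu.
have := near_fst (slope_local u e2) => /= nu.
have [s [As su s0]] : exists s, [/\ A s,
    `|phi s u - phi 0 u - s * d u| <= e / 2 * `|s| & s != 0].
  apply: (@filter_ex _ (0 : R)^'); near=> s; split.
  - by near: s; exact: nbhs_dnbhs.
  - by near: s; exact: nbhs_dnbhs.
  - by near: s; exact: nbhs_dnbhs_neq.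
have := AB (s, u) (conj As Bu) => /= h.
have ns : 0 < `|s| by rewrite normr_gt0.
rewrite -(ler_pM2r ns) -normrM.
have -> : (d u0 - d u) * s = (phi s u - phi 0 u - s * d u) -
   (phi s u - phi 0 u - s * d u0) by ring.
apply: le_trans (ler_normB _ _) _.
by rewrite (splitr e) mulrDl lerD.
Unshelve. all: by end_near. Qed.

End continuity_of_slope.

(** Differentiation under the integral sign.  By compactness the difference
    quotients converge uniformly on a ball that contains all the supports, and
    a uniformly small function supported there has a small integral. *)
Lemma integral_rV_derive (R : realType) n (phi : R -> 'rV[R]_n -> R)
    (d : 'rV[R]_n -> R) r : (forall u, slope phi u (d u)) -> 0 <= r ->
  (\forall s \near (0 : R), compactly_supported r (phi s)) ->
  is_derive (0 : R^o) 1 (fun s : R^o => integral_rV (phi s) : R^o) (integral_rV d).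
Proof.
move=> sphi r0 sup.
have sup0 := nbhs_singleton sup.
have supd : compactly_supported r d.
  split=> [|u ru]; first exact: slope_continuous sphi.
  have dphi := slope_is_derive (sphi u).
  have : is_derive (0 : R^o) 1 (fun s : R^o => phi s u : R^o) 0.
    apply: near_eq_is_derive (is_derive_cst (0 : R^o) (0 : R^o) 1).
    by apply: filterS sup => s [_ ->].
  by move=> /@derive_val <-; rewrite derive_val.
apply: is_derive0P => e e0.
pose C := (2 * r) ^+ n + 1.
have C0 : 0 < C by rewrite ltr_wpDl // exprn_ge0 // mulr_ge0.
have eC : 0 < e / C by rewrite divr_gt0.
have eC2 : 0 < e / C / 2 by rewrite divr_gt0.
have /compact_near_coveringP /(_ _ (nbhs (0 : R)) (fun s u =>
  `|phi s u - phi 0 u - s * d u| <= e / C * `|s|)) := @closed_ball_compact R n r.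
move=> /(_ _) near_s.
have {}near_s : \forall s \near (0 : R), [set v : 'rV[R]_n | `|v| <= r] `<=`
    [set u | `|phi s u - phi 0 u - s * d u| <= e / C * `|s|].
  apply: near_s => u0 _.
  have [[A B] /= [A0 Bu] AB] := slope_local sphi u0 eC2.
  have /cvgrPdist_le /(_ _ eC2) du := @slope_continuous _ _ _ _ sphi u0.
  exists (B `&` [set u | `|d u0 - d u| <= e / C / 2], A) => /=.
    by split => //; exact: filterI.
  move=> [u s] /= [[{}Bu du'] As].
  have /= h := AB (s, u) (conj As Bu).
  have -> : phi s u - phi 0 u - s * d u = (phi s u - phi 0 u - s * d u0) +
    s * (d u0 - d u) by ring.
  apply: le_trans (ler_normD _ _) _.
  by rewrite [e / C]splitr mulrDl lerD // normrM mulrC ler_wpM2r.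
apply: filterS2 near_s sup => s hs sups.
have bnd u : `|(- s) * d u + ((-1) * phi 0 u + phi s u)| <= e / C * `|s|.
  have [/hs /=|ru] := leP `|u| r.
    by congr (`|_| <= _); ring.
  case: sups => _ -> //; case: sup0 => _ -> //; case: supd => _ -> //.
  by rewrite !mulr0 !addr0 normr0 mulr_ge0 // ltW.
have sup1 := compactly_supported_lin (-1) sup0 sups.
have sup2 := compactly_supported_lin (- s) supd sup1.
have := integral_rV_bound r0 sup2 bnd.
rewrite (integral_rV_lin _ r0 supd sup1) (integral_rV_lin _ r0 sup0 sups).
have -> : - s * integral_rV d + (-1 * integral_rV (phi 0) + integral_rV (phi s)) =
  integral_rV (phi s) - integral_rV (phi 0) - s * integral_rV d by ring.
move=> /le_trans; apply; rewrite mulrA ler_wpM2r // mulrCA ler_piMr ?(ltW e0) //.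
by rewrite ler_pdivrMr // mul1r /C lerDl.
Qed.

(** * Directional derivatives *)

Section directional_derivatives.
Variables (R : realType) (V : normedModType R).

Lemma is_derive_line (W : normedModType R) (f : V -> W) a v (t : R) d :
  is_derive (t *: v + a) v f d ->
  is_derive (t : R^o) 1 (fun s : R^o => f (s *: v + a)) d.
Proof.
move=> [fd dE].
have e : (fun h => h^-1 *: (((fun s : R^o => f (s *: v + a)) \o shift (t : R^o)) (h *: 1) -
     f (t *: v + a))) = (fun h => h^-1 *: ((f \o shift (t *: v + a)) (h *: v) - f (t *: v + a))).
  apply/funext => h /=; rewrite /shift; congr (_ *: (f _ - _)).
  by rewrite scalerDl addrA -[h *: 1]/(h * 1) mulr1.
by split; [rewrite /derivable e|rewrite /derive e].
Qed.

Lemma is_derive_coord m n (f : V -> 'M[R]_(m, n)) z v i j : derivable f z v ->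
  is_derive z v (fun z => f z i j : R^o) ('D_v f z i j).
Proof.
move=> fd; split; first exact: (derivable_mxP _ _ _).1 fd i j.
by rewrite derive_mx // mxE.
Qed.

Lemma MVT_from0 (g dg : R -> R) (s : R) :
  (forall t : R, `|t| <= `|s| -> is_derive (t : R^o) 1 (g : R^o -> R^o) (dg t)) ->
  exists2 c, `|c| <= `|s| & g s - g 0 = s * dg c.
Proof.
move=> gd.
have cg t : `|t| <= `|s| -> {for t, continuous g}.
  move=> /gd [gdt _]; apply: differentiable_continuous.
  exact/derivable1_diffP.
have cont (a b : R) : (forall t : R, t \in `[a, b] -> `|t| <= `|s|) ->
    {within `[a, b], continuous g}.
  move=> ab; apply: continuous_in_subspaceT => t /set_mem tab.
  by apply: cg; exact: ab.
have [s0|s0] := leP 0 s.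
  have [t||c cI cE] := @MVT_segment R g dg 0 s s0.
  - rewrite in_itv /= => /andP[t0 ts]; apply: gd.
    by rewrite !ger0_norm // ltW.
  - apply: cont => t; rewrite in_itv /= => /andP[t0 ts].
    by rewrite !ger0_norm.
  - exists c; last by rewrite cE subr0 mulrC.
    by move: cI; rewrite in_itv /= => /andP[t0 ts]; rewrite !ger0_norm.
have [t||c cI cE] := @MVT_segment R g dg s 0 (ltW s0).
- rewrite in_itv /= => /andP[ts t0]; apply: gd.
  by rewrite !ltr0_norm // lerN2 ltW.
- apply: cont => t; rewrite in_itv /= => /andP[ts t0].
  by rewrite (ltr0_norm s0) ler0_norm // lerN2.
- exists c; last by rewrite -[LHS]opprB cE; ring.
  by move: cI; rewrite in_itv /= => /andP[ts t0]; rewrite (ltr0_norm s0) ler0_norm // lerN2.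
Qed.

Lemma near_parallelogram x (v w : V) (P : set V) : nbhs x P ->
  exists2 t : R, 0 < t & forall a b : R, `|a| <= t -> `|b| <= t ->
    P (b *: w + (a *: v + x)).
Proof.
move=> /nbhs_ballP [e /= e0 eP].
pose t := e / (`|v| + `|w| + 1).
have m0 : 0 < `|v| + `|w| + 1 by rewrite ltr_wpDl // addr_ge0.
have t0 : 0 < t by rewrite divr_gt0.
exists t => // a b at_ bt; apply: eP.
rewrite -ball_normE /= distrC addrA addrK.
apply: le_lt_trans (ler_normD _ _) _; rewrite !normrZ.
have -> : e = t * `|w| + t * `|v| + t by rewrite /t; field; rewrite gt_eqF.
by rewrite ltr_pwDr // lerD // ler_wpM2r.
Qed.

(** The second difference over a parallelogram is, by the mean value theorem
    applied once in each direction, a value of the mixed derivative times the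
    square of the step. *)
Lemma mixed_difference x (v w : V) (f fv fvw : V -> R) (P : set V) :
  (forall z, P z -> is_derive z v (f : V -> R^o) (fv z)) ->
  (forall z, P z -> is_derive z w (fv : V -> R^o) (fvw z)) ->
  forall t : R,
  (forall a b : R, `|a| <= `|t| -> `|b| <= `|t| -> P (b *: w + (a *: v + x))) ->
  exists2 y, P y &
    f (t *: w + (t *: v + x)) - f (t *: v + x) - f (t *: w + x) + f x =
    t * (t * fvw y).
Proof.
move=> df dfv t Pt.
have Pt0 (a : R) : `|a| <= `|t| -> P (a *: v + x).
  move=> at_; have := Pt a 0 at_; rewrite scale0r add0r; apply.
  by rewrite normr0.
pose g (a : R) := f (a *: v + (t *: w + x)) - f (a *: v + x).
have [|c ct gE] := @MVT_from0 g
  (fun a => fv (a *: v + (t *: w + x)) - fv (a *: v + x)) t.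
  move=> a at_; apply: is_deriveB; apply: is_derive_line; apply: df.
    by rewrite addrCA; exact: Pt.
  exact: Pt0.
have [|b bt hE] := @MVT_from0 (fun b => fv (b *: w + (c *: v + x)))
  (fun b => fvw (b *: w + (c *: v + x))) t.
  by move=> b bt; apply: is_derive_line; apply: dfv; exact: Pt.
exists (b *: w + (c *: v + x)); first exact: Pt.
move: hE; rewrite scale0r add0r => hE.
rewrite -hE [t *: w + (c *: v + x)]addrCA -gE /g !scale0r !add0r.
by rewrite [t *: w + (t *: v + x)]addrCA; ring.
Qed.

(** Schwarz's theorem: the second difference is symmetric in [v] and [w], so
    that both mixed derivatives take a common value, at two points arbitrarily
    close to [x].
    The derivatives are given as functions because they are coordinates of
    derivatives of vector-valued maps. *)
Lemma derive_commute x (v w : V) (f fv fw fvw fwv : V -> R) :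
  (\forall z \near x, is_derive z v (f : V -> R^o) (fv z)) ->
  (\forall z \near x, is_derive z w (f : V -> R^o) (fw z)) ->
  (\forall z \near x, is_derive z w (fv : V -> R^o) (fvw z)) ->
  (\forall z \near x, is_derive z v (fw : V -> R^o) (fwv z)) ->
  {for x, continuous fvw} -> {for x, continuous fwv} -> fvw x = fwv x.
Proof.
move=> dv dw dvw dwv cvw cwv.
apply/eqP; rewrite -subr_eq0 -normr_le0; apply/ler_addgt0Pr => e e0.
have e2 : 0 < e / 2 by rewrite divr_gt0.
have /cvgrPdist_le/(_ _ e2) /= nvw := cvw.
have /cvgrPdist_le/(_ _ e2) /= nwv := cwv.
pose P z := [/\ is_derive z v (f : V -> R^o) (fv z),
  is_derive z w (f : V -> R^o) (fw z), is_derive z w (fv : V -> R^o) (fvw z),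
  is_derive z v (fw : V -> R^o) (fwv z) &
  `|fvw x - fvw z| <= e / 2 /\ `|fwv x - fwv z| <= e / 2].
have Px : \forall z \near x, P z by near=> z; split; [| | | |split]; near: z.
have [t t0 tP] := near_parallelogram v w Px.
have tt : t = `|t| by rewrite gtr0_norm.
have [|||y [_ _ _ _ [y1 _]] yE] := @mixed_difference x v w f fv fvw P _ _ t.
  by move=> z [].
  by move=> z [].
  by move=> a b; rewrite -tt; exact: tP.
have [|||y' [_ _ _ _ [_ y'1]] y'E] := @mixed_difference x w v f fw fwv P _ _ t.
  by move=> z [].
  by move=> z [].
  by move=> a b at_ bt; rewrite addrCA; apply: tP; rewrite tt.
have eq_yy' : fvw y = fwv y'.
  have tn0 : t != 0 by rewrite gt_eqF.
  apply: (mulfI tn0); apply: (mulfI tn0).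
  rewrite -yE -y'E [t *: v + (t *: w + x)]addrCA; ring.
rewrite add0r (_ : fvw x - fwv x = (fvw x - fvw y) - (fwv x - fwv y')).
  by apply: le_trans (ler_normB _ _) _; rewrite (splitr e) lerD.
by rewrite eq_yy'; ring.
Unshelve. all: by end_near. Qed.

End directional_derivatives.

(** By the mean value theorem the difference quotient in time is a value of the
    time derivative at an intermediate time, hence converges jointly. *)
Lemma slope_C1 (R : realType) (U : normedModType R) (w dw : R^o * U -> R) (u0 : U) :
  (\forall z \near (0 : R^o, u0), is_derive (z : (R^o * U)%type)
     ((1, 0) : (R^o * U)%type) (w : _ -> R^o) (dw z)) ->
  {for (0 : R^o, u0), continuous w} ->
  {for (0 : R^o, u0), continuous dw} ->
  slope (fun s u => w (s, u)) u0 (dw (0, u0)).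
Proof.
move=> dwz cw cdw.
(* at time 0 the quotient is extended by the derivative itself *)
pose q (z : R * U) := if z.1 == 0 then dw (0, z.2) else
  (w (z.1, z.2) - w (0, z.2)) / z.1.
exists q; split.
- apply/cvgrPdist_le => e e0.
  have /cvgrPdist_le/(_ _ e0) := cdw => ne.
  have := filterI dwz ne => -[[A B] /= [/nbhs_ballP [r /= r0 rA] Bu] AB].
  exists (ball (0 : R) r, B) => /=; first by split => //; exact: nbhsx_ballx.
  move=> [s u] /= [sr {}Bu].
  have AB' (t : R) : `|t| <= `|s| ->
      is_derive ((t, u) : (R^o * U)%type) ((1, 0) : (R^o * U)%type)
        (w : _ -> R^o) (dw (t, u)) /\ `|dw (0, u0) - dw (t, u)| <= e.
    move=> ts; apply: (AB (t, u)); split => //=; apply: rA.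
    move: sr; rewrite -!ball_normE /= !sub0r !normrN; exact: le_lt_trans.
  rewrite /q /=; case: eqVneq => [s0|s0].
    by have [] := AB' 0 _; rewrite ?normr0.
  have [|c cs cE] := @MVT_from0 R (fun t => w (t, u)) (fun t => dw (t, u)) s.
    move=> t ts; have [+ _] := AB' t ts.
    have := @is_derive_line R _ _ (w : R^o * U -> R^o) (0, u) (1, 0) t (dw (t, u)).
    have tE (t' : R) : t' *: ((1 : R^o), (0 : U)) + (0, u) = (t', u).
      transitivity (t' * 1 + 0, t' *: (0 : U) + u); first by [].
      by rewrite mulr1 addr0 scaler0 add0r.
    under eq_fun do rewrite tE.
    by rewrite tE.
  rewrite cE mulrC mulKf //.
  by case: (AB' c cs).
- near=> z; rewrite /q; case: eqVneq => [->|z0]; first by rewrite mul0r addr0.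
  by rewrite mulrC divfK // addrC subrK.
- apply: (@continuous_comp _ _ _ (fun u : U => (0, u)) w) => //.
  exact: pairr_continuous.
Unshelve. all: by end_near. Qed.

(** * Jacobians and changes of charts *)

Section smooth_on.
Variables (R : realType) (V W : normedModType R) (U : set V) (f : V -> W).
Hypothesis sf : smooth_on U f.

Lemma smooth_on_differentiable x : U x -> differentiable f x.
Proof. by case: (sf 1) => + _; exact. Qed.

Lemma smooth_on_continuous x : U x -> {for x, continuous f}.
Proof. exact: (sf 0). Qed.

Lemma smooth_on_derive v : smooth_on U ('D_v f).
Proof. by move=> k; case: (sf k.+1) => _; exact. Qed.

End smooth_on.

Section jacobian.
Variable R : realType.

Lemma row_jacobian n m (f : 'rV[R]_n -> 'rV[R]_m) x i : differentiable f x ->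
  row i ('J f x) = partial i f x.
Proof. by move=> df; rewrite rowE /partial deriveEjacobian. Qed.

(** The point [f x] is given a name [y] because in a chart it is only
    propositionally equal to the coordinates of interest. *)
Lemma jacobian_comp n m l (f : 'rV[R]_n -> 'rV[R]_m) (g : 'rV[R]_m -> 'rV[R]_l)
    x y : f x = y -> differentiable f x -> differentiable g y ->
  differentiable (g \o f) x /\ 'J (g \o f) x = 'J f x *m 'J g y.
Proof.
move=> <- df dg; split; first exact: differentiable_comp.
apply/row_matrixP => i.
by rewrite row_mul !rowE /jacobian !mul_rV_lin1 diff_comp.
Qed.

Lemma jacobian_near n m (f g : 'rV[R]_n -> 'rV[R]_m) x :
  differentiable f x -> differentiable g x ->
  {near x, f =1 g} -> 'J f x = 'J g x.
Proof.
move=> df dg fg; apply/row_matrixP => i.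
apply: etrans (row_jacobian i df) _; apply: etrans _ (esym (row_jacobian i dg)).
exact: near_eq_derive.
Qed.

Lemma jacobian_id n (x : 'rV[R]_n) : 'J id x = 1%:M.
Proof.
by apply/row_matrixP => i; rewrite !rowE -deriveEjacobian // derive_id mulmx1.
Qed.

Lemma diff_sum_partial m (G : 'rV[R]_m -> R) y w : differentiable (G : _ -> R^o) y ->
  'd (G : _ -> R^o) y w = \sum_r w 0 r * partial r (G : _ -> R^o) y.
Proof.
move=> dG; rewrite {1}(row_sum_delta w) linear_sum /=; apply: eq_bigr => r _.
by rewrite linearZ /= /partial deriveE.
Qed.

Lemma is_derive_comp (V : normedModType R) m (f : V -> 'rV[R]_m)
    (G : 'rV[R]_m -> R) z v :
  differentiable f z -> differentiable (G : _ -> R^o) (f z) ->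
  is_derive z v (fun z => G (f z) : R^o)
    (\sum_r ('D_v f z) 0 r * partial r (G : _ -> R^o) (f z)).
Proof.
move=> df dG.
have dGf : differentiable (fun z => G (f z) : R^o) z.
  exact: (@differentiable_comp _ _ _ _ f (G : _ -> R^o)).
split; first exact: diff_derivable.
rewrite deriveE // (@diff_comp _ _ _ _ f (G : _ -> R^o)) //= diff_sum_partial //.
by rewrite deriveE.
Qed.

Lemma is_derive_comp1 (V : normedModType R) (g : V -> R) (e e' : R -> R) z v :
  differentiable (g : _ -> R^o) z ->
  is_derive (g z : R^o) 1 (e : R^o -> R^o) (e' (g z)) ->
  is_derive z v (fun z => e (g z) : R^o) ('D_v (g : _ -> R^o) z * e' (g z)).
Proof.
move=> dg [de <-].
have de' : differentiable (e : R^o -> R^o) (g z) by exact/derivable1_diffP.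
have dGf : differentiable (fun z => e (g z) : R^o) z.
  exact: (@differentiable_comp _ _ _ _ (g : _ -> R^o) (e : R^o -> R^o)).
split; first exact: diff_derivable.
rewrite deriveE // (@diff_comp _ _ _ _ (g : _ -> R^o) (e : R^o -> R^o)) //=.
by rewrite deriv1E // derive1E (deriveE v dg).
Qed.

End jacobian.

Section charts.
Variables (R : realType) (m : nat) (M : manifold R m).
Implicit Types (c d : chart R M m) (p : M).

Lemma imgP c p : dom c p -> img c (fwd c p).
Proof. by move=> cp; exists p. Qed.

Lemma img_bwd c u : img c u -> dom c (bwd c u) /\ fwd c (bwd c u) = u.
Proof. by move=> [p cp <-]; rewrite fwdK. Qed.

Lemma near_dom c p : dom c p -> \forall q \near p, dom c q.
Proof. by move=> cp; apply: open_nbhs_nbhs; split => //; exact: open_dom. Qed.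

Lemma near_img c u : img c u -> \forall v \near u, img c v.
Proof. by move=> cu; apply: open_nbhs_nbhs; split => //; exact: open_img. Qed.

Lemma near_bwd_dom c d u : img c u -> dom d (bwd c u) ->
  \forall v \near u, img c v /\ dom d (bwd c v).
Proof.
move=> cu du; near=> v; split; near: v; first exact: near_img.
have := bwd_continuous cu; apply; exact: near_dom.
Unshelve. all: by end_near. Qed.

Lemma transition_differentiable c d p : atlas M c -> atlas M d ->
  dom c p -> dom d p -> differentiable (fwd d \o bwd c) (fwd c p).
Proof.
move=> ac ad cp dp; apply: smooth_on_differentiable (atlas_smooth ac ad) _ _.
by exists p.
Qed.

Lemma to_stdE c p : dom c p ->
  to_std c (fwd c p) = 'J (fwd (chart_at p) \o bwd c) (fwd c p).
Proof. by move=> cp; rewrite /to_std fwdK. Qed.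

Lemma jacobian_transition c d e p : atlas M c -> atlas M d -> atlas M e ->
  dom c p -> dom d p -> dom e p ->
  'J (fwd e \o bwd c) (fwd c p) =
  'J (fwd d \o bwd c) (fwd c p) *m 'J (fwd e \o bwd d) (fwd d p).
Proof.
move=> ac ad ae cp dp ep.
have d1 := transition_differentiable ac ad cp dp.
have d2 := transition_differentiable ad ae dp ep.
have E : (fwd d \o bwd c) (fwd c p) = fwd d p by rewrite /= fwdK.
have [d12 <-] := jacobian_comp E d1 d2.
apply: jacobian_near; [exact: transition_differentiable|exact: d12|].
have ic := imgP cp.
have nd : dom d (bwd c (fwd c p)) by rewrite fwdK.
by apply: filterS (near_bwd_dom ic nd) => v [_ dv] /=; rewrite fwdK.
Qed.

Lemma jacobian_transition_id c p : atlas M c -> dom c p ->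
  'J (fwd c \o bwd c) (fwd c p) = 1%:M.
Proof.
move=> ac cp; rewrite -(jacobian_id (fwd c p)); apply: jacobian_near => //.
- exact: transition_differentiable.
- by apply: filterS (near_img (imgP cp)) => u /img_bwd [_ /=].
Qed.

Lemma to_std_chart_at p : to_std (chart_at p) (fwd (chart_at p) p) = 1%:M.
Proof.
rewrite to_stdE ?jacobian_transition_id //; first exact: chart_at_atlas.
all: exact: chart_at_dom.
Qed.

(** The inverse is the Jacobian of the opposite change of charts. *)
Lemma to_std_unit c p : atlas M c -> dom c p -> to_std c (fwd c p) \in unitmx.
Proof.
move=> ac cp.
have ap := chart_at_atlas p; have dp := chart_at_dom p.
have := jacobian_transition ac ap ac cp dp cp.
rewrite jacobian_transition_id // -to_stdE // => /esym /mulmx1_unit [tu _].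
exact: tu.
Qed.

Lemma bilin_in_chart_at (B : M -> 'M[R]_m) p :
  bilin_in (chart_at p) B (fwd (chart_at p) p) = B p.
Proof.
rewrite /bilin_in to_std_chart_at mul1mx trmx1 mulmx1 fwdK //.
exact: chart_at_dom.
Qed.

End charts.

Section differential.
Variables (R : realType) (n m : nat) (N : manifold R n) (M : manifold R m).
Variables (F : N -> M) (sF : smooth_map F).
Variables (a : chart R N n) (b : chart R M m) (aN : atlas N a) (bM : atlas M b).

Lemma near_rep u : img a u -> dom b (F (bwd a u)) ->
  \forall v \near u, img a v /\ dom b (F (bwd a v)).
Proof.
move=> au bu.
have nF : \forall y \near bwd a u, dom b (F y).
  by case: sF => cF _; apply: cF; exact: near_dom.
have nu : \forall v \near u, dom b (F (bwd a v)) by exact: (bwd_continuous au nF).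
exact: filterI (near_img au) nu.
Qed.

Lemma rep_differentiable u : img a u -> dom b (F (bwd a u)) ->
  differentiable (fwd b \o F \o bwd a) u.
Proof.
move=> au bu; case: sF => _ /(_ a b aN bM) sab.
exact: smooth_on_differentiable sab _ _.
Qed.

End differential.

Section differential_in_charts.
Variables (R : realType) (n m : nat) (N : manifold R n) (M : manifold R m).
Variables (F : N -> M) (sF : smooth_map F).
Variables (a : chart R N n) (b : chart R M m) (aN : atlas N a) (bM : atlas M b).

(** The chain rule for the square formed by two representations of [F] and the
    changes of charts between them. *)
Lemma jacobian_rep (a' : chart R N n) (b' : chart R M m) x :
  atlas N a' -> atlas M b' -> dom a x -> dom a' x -> dom b (F x) -> dom b' (F x) ->
  'J (fwd a' \o bwd a) (fwd a x) *m 'J (fwd b' \o F \o bwd a') (fwd a' x) =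
  'J (fwd b \o F \o bwd a) (fwd a x) *m 'J (fwd b' \o bwd b) (fwd b (F x)).
Proof.
move=> aN' bM' ax ax' bx bx'.
have bx1 : dom b (F (bwd a (fwd a x))) by rewrite fwdK.
have bx1' : dom b' (F (bwd a (fwd a x))) by rewrite fwdK.
have bx2' : dom b' (F (bwd a' (fwd a' x))) by rewrite fwdK.
have d1 := transition_differentiable aN aN' ax ax'.
have d2 := rep_differentiable sF aN' bM' (imgP ax') bx2'.
have d3 := rep_differentiable sF aN bM (imgP ax) bx1.
have d4 := transition_differentiable bM bM' bx bx'.
have d5 := rep_differentiable sF aN bM' (imgP ax) bx1'.
have E1 : (fwd a' \o bwd a) (fwd a x) = fwd a' x by rewrite /= fwdK.
have E2 : (fwd b \o F \o bwd a) (fwd a x) = fwd b (F x) by rewrite /= fwdK.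
have [d12 <-] := jacobian_comp E1 d1 d2; have [d34 <-] := jacobian_comp E2 d3 d4.
transitivity ('J (fwd b' \o F \o bwd a) (fwd a x)).
  apply: jacobian_near; [exact: d12|exact: d5|].
  have ia' : dom a' (bwd a (fwd a x)) by rewrite fwdK.
  by apply: filterS (near_bwd_dom (imgP ax) ia') => v [_ av] /=; rewrite fwdK.
apply: jacobian_near; [exact: d5|exact: d34|].
by apply: filterS (near_rep sF (imgP ax) bx1) => v [_ bv] /=; rewrite fwdK.
Qed.

Lemma to_std_differential x : dom a x -> dom b (F x) ->
  to_std a (fwd a x) *m differential F x =
  'J (fwd b \o F \o bwd a) (fwd a x) *m to_std b (fwd b (F x)).
Proof.
move=> ax bx; rewrite !to_stdE // /differential.
apply: jacobian_rep => //; by [exact: chart_at_atlas|exact: chart_at_dom].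
Qed.

(** The pulled-back metric, defined through the preferred charts, is the usual
    expression in any pair of charts; the right-hand side is the one that
    depends smoothly on the point. *)
Lemma bilin_in_pullback (g : M -> 'M[R]_m) x : dom a x -> dom b (F x) ->
  let J := 'J (fwd b \o F \o bwd a) (fwd a x) in
  bilin_in a (pullback F g) (fwd a x) = J *m bilin_in b g (fwd b (F x)) *m J^T.
Proof.
move=> ax bx J; rewrite /bilin_in !fwdK // /pullback.
rewrite !mulmxA to_std_differential // -/J -!mulmxA -!trmx_mul.
by rewrite to_std_differential // trmx_mul !mulmxA.
Qed.

End differential_in_charts.

(** * Positive definite matrices *)

Section positive_definite.
Variable R : realType.

Lemma cvg_sum_fin (T : Type) (F : set_system T) (FF : Filter F) (I : Type)
    (r : seq I) (f : I -> T -> R) (l : I -> R) :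
  (forall i, f i x @[x --> F] --> l i) ->
  \sum_(i <- r) f i x @[x --> F] --> \sum_(i <- r) l i.
Proof.
move=> fl; elim: r => [|i r IH].
  by rewrite big_nil; under eq_fun do rewrite big_nil; exact: cvg_cst.
by rewrite big_cons; under eq_fun do rewrite big_cons; exact: cvgD (fl i) IH.
Qed.

Lemma cvg_det (T : Type) (F : set_system T) (FF : Filter F) n
    (A : T -> 'M[R]_n) (L : 'M[R]_n) :
  (forall i j, A x i j @[x --> F] --> L i j) -> \det (A x) @[x --> F] --> \det L.
Proof.
move=> AL; rewrite /determinant; apply: cvg_sum_fin => s.
apply: cvgM; first exact: cvg_cst.
elim: (index_enum _) => [|i r IH].
  by rewrite big_nil; under eq_fun do rewrite big_nil; exact: cvg_cst.
by rewrite big_cons; under eq_fun do rewrite big_cons; exact: cvgM (AL _ _) IH.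
Qed.

Definition posdef n (A : 'M[R]_n) :=
  forall v : 'rV[R]_n, v != 0 -> 0 < (v *m A *m v^T) 0 0.

Lemma posdef_unit n (A : 'M[R]_n) : posdef A -> A \in unitmx.
Proof.
move=> pA; rewrite -row_free_unit -kermx_eq0; apply/eqP/row_matrixP => i.
rewrite row0; apply/eqP/negPn/negP => /pA.
by rewrite -row_mul mulmx_ker row0 mul0mx mxE ltxx.
Qed.

(** The segment from the identity to [A] consists of positive definite, hence
    invertible, matrices, so the determinant does not change sign along it. *)
Lemma posdef_det_gt0 n (A : 'M[R]_n) : posdef A -> 0 < \det A.
Proof.
move=> pA.
pose B (t : R) := (1 - t) *: 1%:M + t *: A.
have pB t : 0 <= t <= 1 -> posdef (B t).
  move=> /andP[t0 t1] v v0.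
  have v2 : 0 < (v *m v^T) 0 0.
    have [i vi] : exists i, v 0 i != 0.
      apply/existsP; apply: contraNT v0 => /existsPn v0.
      by apply/eqP/rowP => i; rewrite mxE; apply/eqP/negPn/v0.
    rewrite mxE (bigD1 i) //= mxE ltr_pwDl //.
      by rewrite -expr2 exprn_even_gt0.
    by apply: sumr_ge0 => j _; rewrite mxE -expr2 sqr_ge0.
  rewrite /B mulmxDr mulmxDl -!scalemxAr -!scalemxAl mulmx1 !mxE.
  rewrite mxE in v2; have := pA v v0; rewrite mxE => pv.
  have [->|tn] := eqVneq t 0; first by rewrite subr0 mul1r mul0r addr0.
  apply: ltr_wpDl; first by rewrite mulr_ge0 ?subr_ge0 // ltW.
  by rewrite mulr_gt0 // lt_def tn.
have cB : continuous (fun t : R => \det (B t)).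
  move=> t; apply: cvg_det => i j.
  rewrite /B !mxE; under eq_fun do rewrite !mxE.
  apply: cvgD; apply: cvgMr_tmp; last exact: cvg_id.
  by apply: cvgB; [exact: cvg_cst|exact: cvg_id].
rewrite ltNge; apply/negP => d0.
have := @IVT R (fun t => \det (B t)) 0 1 0 ler01.
have B0 : B 0 = 1%:M by rewrite /B subr0 scale1r scale0r addr0.
have B1 : B 1 = A by rewrite /B subrr scale0r scale1r add0r.
rewrite B0 B1 det1; case.
- exact: continuous_subspaceT.
- by rewrite ge_min d0 orbT /= le_max ler01.
- move=> t; rewrite in_itv /= => /pB /posdef_unit.
  by rewrite unitmxE unitfE => /eqP.
Qed.

End positive_definite.

(** * Algebra of the first variation *)

Section algebra.
Variable R : realType.

Lemma bilinearE m (x y : 'rV[R]_m) (B : 'M[R]_m) :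
  (x *m B *m y^T) 0 0 = \sum_p \sum_q x 0 p * B p q * y 0 q.
Proof.
rewrite mxE exchange_big /=; apply: eq_bigr => q _.
by rewrite !mxE mulr_suml.
Qed.

(** Lowering the index of the Christoffel symbols with the metric [B] recovers
    the Koszul formula; [dB p q r] stands for the derivative of [B q r] in the
    direction [p]. *)
Lemma koszul_contraction m (B : 'M[R]_m) (dB : 'I_m -> 'I_m -> 'I_m -> R)
    (a b : 'I_m -> R) l : B \in unitmx ->
  \sum_k B l k * (\sum_p \sum_q (2^-1 * \sum_r invmx B k r *
    (dB p q r + dB q p r - dB r p q)) * a p * b q) =
  2^-1 * \sum_p \sum_q (dB p q l + dB q p l - dB l p q) * (a p * b q).
Proof.
move=> uB.
under eq_bigr do rewrite mulr_sumr.
rewrite exchange_big mulr_sumr; apply: eq_bigr => p _.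
under eq_bigr do rewrite mulr_sumr.
rewrite exchange_big mulr_sumr; apply: eq_bigr => q _.
pose c r := dB p q r + dB q p r - dB r p q.
transitivity (2^-1 * (\sum_k \sum_r B l k * invmx B k r * c r) * (a p * b q)).
  rewrite mulr_sumr mulr_suml; apply: eq_bigr => k _.
  transitivity (2^-1 * (B l k * \sum_r invmx B k r * c r) * (a p * b q)).
    by rewrite /c; ring.
  by congr (_ * _ * _); rewrite mulr_sumr; apply: eq_bigr => r _; rewrite mulrA.
rewrite -mulrA; congr (_ * (_ * _)); rewrite exchange_big /=.
transitivity (\sum_r (B *m invmx B) l r * c r).
  by apply: eq_bigr => r _; rewrite mxE mulr_suml.
rewrite mulmxV // (bigD1 l) //= big1 ?addr0; first by rewrite mxE eqxx mul1r.
by move=> r rl; rewrite mxE eq_sym (negPf rl) mul0r.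
Qed.

(** The computation behind the first variation of the induced metric.  Here [a]
    and [b] are two tangent vectors, [Y] is the velocity, [Ya] and [Yb] are its
    derivatives along [a] and [b], [ab] and [ba] the second derivatives of the
    immersion, [Gab] and [Gba] the Christoffel terms.  The two vanishing sums
    are the derivatives of the normality of [Y]; the left-hand side of the
    conclusion is the time derivative of [B(a, b)], the right-hand side is
    [- B(Y, D_a b) - B(Y, D_b a)]. *)
Lemma variation_algebra m (B : 'M[R]_m) (dB : 'I_m -> 'I_m -> 'I_m -> R)
    (Y a b Ya Yb ab ba Gab Gba : 'I_m -> R) :
  (forall p q, B p q = B q p) -> (forall r p q, dB r p q = dB r q p) ->
  (forall l, \sum_k B l k * Gab k =
    2^-1 * \sum_p \sum_q (dB p q l + dB q p l - dB l p q) * (a p * b q)) ->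
  (forall l, \sum_k B l k * Gba k =
    2^-1 * \sum_p \sum_q (dB p q l + dB q p l - dB l p q) * (b p * a q)) ->
  \sum_p \sum_q ((Ya p * B p q + Y p * \sum_r a r * dB r p q) * b q +
    Y p * B p q * ab q) = 0 ->
  \sum_p \sum_q ((Yb p * B p q + Y p * \sum_r b r * dB r p q) * a q +
    Y p * B p q * ba q) = 0 ->
  \sum_p \sum_q ((Ya p * B p q + a p * \sum_r Y r * dB r p q) * b q +
    a p * B p q * Yb q) =
  - (\sum_p \sum_q Y p * B p q * (ab q + Gab q) +
     \sum_p \sum_q Y p * B p q * (ba q + Gba q)).
Proof.
move=> Bs dBs Gab_ Gba_ Nab Nba.
pose sum3 (t : 'I_m -> 'I_m -> 'I_m -> R) := \sum_l \sum_p \sum_q t l p q.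
have sum3D t t' : sum3 (fun l p q => t l p q + t' l p q) = sum3 t + sum3 t'.
  rewrite /sum3 -big_split; apply: eq_bigr => l _; rewrite -big_split.
  by apply: eq_bigr => p _; rewrite -big_split.
have sum2D (t t' : 'I_m -> 'I_m -> R) : \sum_p \sum_q (t p q + t' p q) =
    \sum_p \sum_q t p q + \sum_p \sum_q t' p q.
  by rewrite -big_split; apply: eq_bigr => p _; rewrite -big_split.
pose L (x y : 'I_m -> R) := \sum_p \sum_q x p * B p q * y q.
pose P (x y : 'I_m -> R) := sum3 (fun l p q => Y l * (dB p q l * (x p * y q))).
pose Q (x y : 'I_m -> R) := sum3 (fun l p q => Y l * (dB l p q * (x p * y q))).
(* L is a value of the metric; P and Q are the two ways in which the
   derivative of the metric is contracted with Y, x and y *)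
have Lsym x y : L x y = L y x.
  rewrite /L exchange_big; apply: eq_bigr => p _; apply: eq_bigr => q _.
  by rewrite (Bs q p); ring.
have Qsym x y : Q x y = Q y x.
  rewrite /Q /sum3; apply: eq_bigr => l _; rewrite exchange_big.
  by apply: eq_bigr => p _; apply: eq_bigr => q _; rewrite (dBs l q p); ring.
have PE x y : \sum_p \sum_q Y p * (\sum_r x r * dB r p q) * y q = P x y.
  apply: eq_bigr => l _.
  transitivity (\sum_q \sum_r Y l * (dB r q l * (x r * y q))); last exact: exchange_big.
  apply: eq_bigr => q _; rewrite mulr_sumr mulr_suml; apply: eq_bigr => r _.
  by rewrite (dBs r l q); ring.
have QE x y : \sum_p \sum_q x p * (\sum_r Y r * dB r p q) * y q = Q x y.
  rewrite /Q /sum3 [RHS]exchange_big /=; apply: eq_bigr => p _.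
  rewrite [RHS]exchange_big /=; apply: eq_bigr => q _.
  rewrite mulr_sumr mulr_suml; apply: eq_bigr => r _; ring.
pose K (x y : 'I_m -> R) :=
  sum3 (fun l p q => Y l * ((dB p q l + dB q p l - dB l p q) * (x p * y q))).
have KE x y : K x y = P x y + P y x - Q x y.
  apply: (addIr (Q x y)); rewrite subrK.
  have -> : P y x = sum3 (fun l p q => Y l * (dB q p l * (x p * y q))).
    rewrite /P /sum3; apply: eq_bigr => l _; rewrite exchange_big.
    by apply: eq_bigr => p _; apply: eq_bigr => q _; ring.
  rewrite -!sum3D; apply: eq_bigr => l _; apply: eq_bigr => p _.
  by apply: eq_bigr => q _; ring.
have GE x y (G : 'I_m -> R) : (forall l, \sum_k B l k * G k =
    2^-1 * \sum_p \sum_q (dB p q l + dB q p l - dB l p q) * (x p * y q)) ->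
    L Y G = 2^-1 * K x y.
  move=> GE; rewrite /L /K /sum3 mulr_sumr; apply: eq_bigr => l _.
  transitivity (Y l * \sum_k B l k * G k).
    by rewrite mulr_sumr; apply: eq_bigr => k _; rewrite mulrA.
  rewrite GE mulrCA mulr_sumr; congr (_ * _); apply: eq_bigr => p _.
  by rewrite mulr_sumr.
have LD x y z : \sum_p \sum_q x p * B p q * (y q + z q) = L x y + L x z.
  by rewrite -sum2D; apply: eq_bigr => p _; apply: eq_bigr => q _; rewrite mulrDr.
have split3 (x y z x' y' : 'I_m -> R) (C : 'I_m -> 'I_m -> R) :
    \sum_p \sum_q ((x p * B p q + y p * C p q) * z q + x' p * B p q * y' q) =
    L x z + \sum_p \sum_q y p * C p q * z q + L x' y'.
  rewrite -!sum2D; apply: eq_bigr => p _; apply: eq_bigr => q _; ring.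
move: Nab Nba; rewrite !split3 !PE QE !LD (GE a b Gab) // (GE b a Gba) // !KE.
rewrite (Lsym a Yb) (Qsym b a) => Nab Nba.
have -> : L Ya b = - (P a b + L Y ab).
  by apply/eqP; rewrite -addr_eq0 addrA Nab.
have -> : L Yb a = - (P b a + L Y ba).
  by apply/eqP; rewrite -addr_eq0 addrA Nba.
by field.
Qed.

End algebra.

Lemma coord_cont (R : realType) (T : topologicalType) m n (g : T -> 'M[R]_(m, n)) z i j :
  {for z, continuous g} -> {for z, continuous (fun z => g z i j)}.
Proof.
move=> cg; apply: (@continuous_comp _ _ _ g (fun A : 'M[R]_(m, n) => A i j)) => //.
exact: coord_continuous.
Qed.

Section is_derive_product.
Variables (R : realType) (V : normedModType R).
Implicit Types (f g : V -> R) (z v : V).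

Lemma is_derive_mul f g z v (df dg : R) :
  is_derive z v (f : _ -> R^o) df -> is_derive z v (g : _ -> R^o) dg ->
  is_derive z v (fun z => f z * g z : R^o) (df * g z + f z * dg).
Proof.
move=> hf hg; apply: is_derive_eq (is_deriveM hf hg) _.
by rewrite addrC; congr (_ + _); rewrite /GRing.scale /= mulrC.
Qed.

Lemma is_derive_add f g z v (df dg : R) :
  is_derive z v (f : _ -> R^o) df -> is_derive z v (g : _ -> R^o) dg ->
  is_derive z v (fun z => f z + g z : R^o) (df + dg).
Proof. by move=> hf hg; exact: is_deriveD. Qed.

Lemma is_derive_bigsum n (f : 'I_n -> V -> R) z v (df : 'I_n -> R) :
  (forall i, is_derive z v (f i : _ -> R^o) (df i)) ->
  is_derive z v (fun z => \sum_i f i z : R^o) (\sum_i df i).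
Proof.
move=> hf; rewrite (_ : (fun z => _) = \sum_i (f i : V -> R^o)).
  exact: is_derive_sum.
by apply/funext => y; rewrite fct_sumE.
Qed.

End is_derive_product.

(** * Variation of the induced metric in coordinates *)

Section slices.
Variables (R : realType) (U W : normedModType R) (N : (R^o * U)%type -> W).
Variables (s : R^o) (u v : U).

Let quotientE :
  (fun h : R => h^-1 *: ((N \o shift (s, u)) (h *: ((0 : R^o), v)) - N (s, u))) =
  (fun h : R => h^-1 *: (((fun u => N (s, u)) \o shift u) (h *: v) - N (s, u))).
Proof.
apply/funext => h.
have pE : h *: ((0 : R^o), v) + (s, u) = (s, h *: v + u).
  transitivity (h * 0 + s : R^o, h *: v + u); first by [].
  by rewrite mulr0 add0r.
by rewrite /= pE.
Qed.

Lemma derive_space : 'D_((0 : R^o), v) N (s, u) = 'D_v (fun u => N (s, u)) u.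
Proof. by rewrite /derive quotientE. Qed.

Lemma derivable_space :
  derivable N (s, u) ((0 : R^o), v) = derivable (fun u => N (s, u)) u v.
Proof. by rewrite /derivable quotientE. Qed.

End slices.

Section time_slices.
Variables (R : realType) (U W : normedModType R) (N : (R^o * U)%type -> W).
Variables (s : R^o) (u : U).

Let quotientE :
  (fun h : R => h^-1 *: ((N \o shift (s, u)) (h *: ((1 : R^o), (0 : U))) -
    N (s, u))) =
  (fun h : R => h^-1 *: (((fun t : R^o => N (t, u)) \o shift s) (h *: (1 : R^o)) -
    N (s, u))).
Proof.
apply/funext => h.
have pE : h *: ((1 : R^o), (0 : U)) + (s, u) = (h *: (1 : R^o) + s, u).
  transitivity (h *: (1 : R^o) + s : R^o, h *: (0 : U) + u); first by [].
  by rewrite scaler0 add0r.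
by rewrite /= pE.
Qed.

Lemma derive_time :
  'D_((1 : R^o), (0 : U)) N (s, u) = 'D_1 (fun t : R^o => N (t, u)) s.
Proof. by rewrite /derive quotientE. Qed.

Lemma derivable_time :
  derivable N (s, u) ((1 : R^o), (0 : U)) = derivable (fun t : R^o => N (t, u)) s 1.
Proof. by rewrite /derivable quotientE. Qed.

End time_slices.

(** A variation read in charts is a map [f] of time and space, smooth near
    time [0], and [B] is the metric of the target in coordinates, smooth on the image [O]
    of a chart. *)
Section local_variation.
Variables (R : realType) (n m : nat).
Let V : normedModType R := (R^o * 'rV[R]_n)%type.
Let time : V := (1, 0).
Let space (i : 'I_n) : V := (0, delta_mx 0 i).

Variables (f : V -> 'rV[R]_m) (Omega : set V) (u0 : 'rV[R]_n).
Let z0 : V := (0, u0).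
Hypotheses (nOmega : nbhs z0 Omega) (sf : smooth_on Omega f).

Definition velocity (z : V) : 'rV[R]_m := 'D_time f z.
Definition tangent (i : 'I_n) (z : V) : 'rV[R]_m := 'D_(space i) f z.

Lemma mixed_derivative i p :
  'D_time (tangent i) z0 0 p = 'D_(space i) velocity z0 0 p.
Proof.
have Omega0 := nbhs_singleton nOmega.
apply/esym.
apply: (@derive_commute _ _ z0 time (space i) (fun z => f z 0 p)
  (fun z => velocity z 0 p) (fun z => tangent i z 0 p)
  (fun z => 'D_(space i) velocity z 0 p) (fun z => 'D_time (tangent i) z 0 p)).
- apply: filterS nOmega => z Oz; apply: is_derive_coord.
  exact: diff_derivable (smooth_on_differentiable sf Oz).
- apply: filterS nOmega => z Oz; apply: is_derive_coord.
  exact: diff_derivable (smooth_on_differentiable sf Oz).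
- apply: filterS nOmega => z Oz; apply: is_derive_coord.
  exact: diff_derivable (smooth_on_differentiable (smooth_on_derive sf _) Oz).
- apply: filterS nOmega => z Oz; apply: is_derive_coord.
  exact: diff_derivable (smooth_on_differentiable (smooth_on_derive sf _) Oz).
- apply: coord_cont.
  exact: smooth_on_continuous (smooth_on_derive (smooth_on_derive sf _) _) _ Omega0.
- apply: coord_cont.
  exact: smooth_on_continuous (smooth_on_derive (smooth_on_derive sf _) _) _ Omega0.
Qed.

Lemma slope_tangent i p :
  slope (fun s u => tangent i (s, u) 0 p) u0 ('D_(space i) velocity z0 0 p).
Proof.
rewrite -mixed_derivative.
have Omega0 := nbhs_singleton nOmega.
apply: (@slope_C1 R _ (fun z => tangent i z 0 p)
  (fun z => 'D_time (tangent i) z 0 p)).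
- apply: filterS nOmega => z Oz; apply: is_derive_coord.
  exact: diff_derivable (smooth_on_differentiable (smooth_on_derive sf _) Oz).
- apply: coord_cont.
  exact: smooth_on_continuous (smooth_on_derive sf _) _ Omega0.
- apply: coord_cont.
  exact: smooth_on_continuous (smooth_on_derive (smooth_on_derive sf _) _) _ Omega0.
Qed.

Variable O : set 'rV[R]_m.
Hypothesis fO : forall z, Omega z -> O (f z).

Lemma cvg_rep : {for z0, continuous f}.
Proof. exact: smooth_on_continuous sf _ (nbhs_singleton nOmega). Qed.

Lemma slope_comp_coord k l (B : 'rV[R]_m -> 'M[R]_(k, l)) p q : smooth_on O B ->
  slope (fun s u => B (f (s, u)) p q) u0
    (\sum_r velocity z0 0 r * partial r (fun v => B v p q : R^o) (f z0)).
Proof.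
move=> sB; have Omega0 := nbhs_singleton nOmega.
have dB y r : O y ->
    partial r (fun v => B v p q : R^o) y = 'D_(delta_mx 0 r) B y p q.
  move=> Oy; rewrite /partial.
  have := @is_derive_coord R _ _ _ B y (delta_mx 0 r) p q
    (diff_derivable (smooth_on_differentiable sB Oy)).
  by move=> /@derive_val.
under eq_bigr do rewrite (dB _ _ (fO Omega0)).
apply: (@slope_C1 R _ (fun z => B (f z) p q)
  (fun z => \sum_r velocity z 0 r * 'D_(delta_mx 0 r) B (f z) p q)).
- apply: filterS nOmega => z Oz; have Of := fO Oz.
  have df := smooth_on_differentiable sf Oz.
  have dBf := smooth_on_differentiable sB Of.
  have dG : differentiable (fun v => B v p q : R^o) (f z).
    apply: (@differentiable_comp _ _ _ _ B (fun A : 'M[R]_(k, l) => A p q : R^o)) => //.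
    exact: differentiable_coord.
  have := is_derive_comp time df dG.
  by under eq_bigr do rewrite (dB _ _ Of).
- apply: (@continuous_comp _ _ _ f (fun v => B v p q)); first exact: cvg_rep.
  by apply: coord_cont; exact: smooth_on_continuous sB _ (fO Omega0).
- apply: cvg_sum_fin => r; apply: cvgM.
    apply: coord_cont.
    exact: smooth_on_continuous (smooth_on_derive sf _) _ Omega0.
  apply: (@continuous_comp _ _ _ f (fun v => 'D_(delta_mx 0 r) B v p q)).
    exact: cvg_rep.
  apply: coord_cont.
  exact: smooth_on_continuous (smooth_on_derive sB _) _ (fO Omega0).
Qed.

Lemma slope_exp_comp (phi : 'rV[R]_m -> R^o) (c : R) : smooth_on O phi ->
  slope (fun s u => expR (c * phi (f (s, u)))) u0
    ((\sum_r velocity z0 0 r * partial r phi (f z0)) * (c * expR (c * phi (f z0)))).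
Proof.
move=> sphi; have Omega0 := nbhs_singleton nOmega.
have cexp (g : V -> R) : {for z0, continuous g} ->
    {for z0, continuous (fun z => expR (c * g z))}.
  move=> cg; apply: (@continuous_comp _ _ _ (fun z => c * g z) expR).
    exact: cvgMl_tmp cg.
  exact: continuous_expR.
have cphi : {for z0, continuous (fun z => phi (f z))}.
  apply: (@continuous_comp _ _ _ f phi); first exact: cvg_rep.
  exact: smooth_on_continuous sphi _ (fO Omega0).
apply: (@slope_C1 R _ (fun z => expR (c * phi (f z))) (fun z =>
  (\sum_r velocity z 0 r * partial r phi (f z)) * (c * expR (c * phi (f z))))).
- apply: filterS nOmega => z Oz; have Of := fO Oz.
  have df := smooth_on_differentiable sf Oz.
  have dphi := smooth_on_differentiable sphi Of.
  have dg : differentiable (fun z => phi (f z)) z.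
    exact: (@differentiable_comp _ _ _ _ f phi).
  have <- := @derive_val _ _ _ _ _ _ _ (is_derive_comp time df dphi).
  apply: (@is_derive_comp1 R V (fun z => phi (f z)) (fun t => expR (c * t))
    (fun t => c * expR (c * t)) z time dg).
  have dc := is_deriveZ c (is_derive_id (phi (f z) : R^o) 1).
  have := @is_derive1_comp R expR (c \*: (id : R^o -> R^o)) (phi (f z)) _ _
    (is_derive_expR _) dc.
  by move=> h; apply: is_derive_eq h _; rewrite mulrC; congr (_ * _); exact: mulr1.
- exact: cexp.
- apply: (@cvgM R _ _ _); last by apply: cvgM; [exact: cvg_cst|exact: cexp].
  apply: cvg_sum_fin => r; apply: cvgM.
    apply: coord_cont.
    exact: smooth_on_continuous (smooth_on_derive sf _) _ Omega0.
  apply: (@continuous_comp _ _ _ f (partial r phi)); first exact: cvg_rep.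
  exact: smooth_on_continuous (smooth_on_derive sphi _) _ (fO Omega0).
Qed.

Variable B : 'rV[R]_m -> 'M[R]_m.
Hypotheses (sB : smooth_on O B) (Bsym : forall v p q, B v p q = B v q p).
Hypothesis Bunit : B (f z0) \in unitmx.
Hypothesis normal : \forall u \near u0, forall j,
  (velocity (0, u) *m B (f (0, u)) *m (tangent j (0, u))^T) 0 0 = 0.

(** The covariant derivative of the [j]-th tangent vector in the direction of
    the [i]-th, at time [0]. *)
Definition acceleration i j : 'rV[R]_m :=
  'D_(space i) (tangent j) z0 +
  \row_k \sum_p \sum_q
    christoffel B k p q (f z0) * tangent i z0 0 p * tangent j z0 0 q.

Let dB r p q := partial r (fun v => B v p q : R^o) (f z0).

(** Normality holds along all of the submanifold at time [0], so it can be
    differentiated in the space directions. *)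
Lemma normal_derivative i j :
  \sum_p \sum_q (('D_(space i) velocity z0 0 p * B (f z0) p q +
     velocity z0 0 p * \sum_r tangent i z0 0 r * dB r p q) * tangent j z0 0 q +
    velocity z0 0 p * B (f z0) p q * 'D_(space i) (tangent j) z0 0 q) = 0.
Proof.
have Omega0 := nbhs_singleton nOmega.
pose N (z : V) := \sum_p \sum_q velocity z 0 p * B (f z) p q * tangent j z 0 q.
have dN : is_derive z0 (space i) (N : _ -> R^o) 0.
  have nN : \forall u \near u0, N (0, u) = 0.
    by apply: filterS normal => u /(_ j); rewrite bilinearE.
  have dN0 : is_derive u0 (delta_mx 0 i) (fun u => N (0, u) : R^o) 0.
    apply: near_eq_is_derive (is_derive_cst (0 : R^o) u0 (delta_mx 0 i)).
    by apply: filterS nN => u ->.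
  case: dN0 => d1 d2; split; first by rewrite /z0 /space derivable_space.
  by rewrite /z0 /space derive_space.
have dN' : is_derive z0 (space i) (N : _ -> R^o)
  (\sum_p \sum_q (('D_(space i) velocity z0 0 p * B (f z0) p q +
     velocity z0 0 p * \sum_r tangent i z0 0 r * dB r p q) * tangent j z0 0 q +
    velocity z0 0 p * B (f z0) p q * 'D_(space i) (tangent j) z0 0 q)).
  apply: is_derive_bigsum => p; apply: is_derive_bigsum => q.
  have D v w : derivable ('D_w f) z0 v.
    exact: diff_derivable (smooth_on_differentiable (smooth_on_derive sf _) Omega0).
  apply: is_derive_mul; last exact: is_derive_coord (D _ _).
  apply: is_derive_mul; first exact: is_derive_coord (D _ _).
  apply: (@is_derive_comp _ _ _ f (fun v => B v p q)).
    exact: smooth_on_differentiable sf _ Omega0.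
  apply: (@differentiable_comp _ _ _ _ B (fun A : 'M[R]_m => A p q : R^o)).
    exact: smooth_on_differentiable sB _ (fO Omega0).
  exact: differentiable_coord.
by rewrite -(@derive_val _ _ _ _ _ _ _ dN') (@derive_val _ _ _ _ _ _ _ dN).
Qed.

(** The time derivative of the induced metric is minus the symmetrized second
    fundamental form contracted with the velocity. *)
Lemma first_variation_metric i j :
  slope (fun s u => (tangent i (s, u) *m B (f (s, u)) *m (tangent j (s, u))^T) 0 0)
    u0 (- ((velocity z0 *m B (f z0) *m (acceleration i j)^T) 0 0 +
           (velocity z0 *m B (f z0) *m (acceleration j i)^T) 0 0)).
Proof.
under [X in slope X]eq_fun do under eq_fun do rewrite bilinearE.
have G a b l : \sum_k B (f z0) l k *
    (\sum_p \sum_q christoffel B k p q (f z0) * a p * b q) =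
    2^-1 * \sum_p \sum_q (dB p q l + dB q p l - dB l p q) * (a p * b q).
  exact: koszul_contraction.
have E : \sum_p \sum_q
   (('D_(space i) velocity z0 0 p * B (f z0) p q +
     tangent i z0 0 p * \sum_r velocity z0 0 r * dB r p q) * tangent j z0 0 q +
    tangent i z0 0 p * B (f z0) p q * 'D_(space j) velocity z0 0 q) =
  - ((velocity z0 *m B (f z0) *m (acceleration i j)^T) 0 0 +
           (velocity z0 *m B (f z0) *m (acceleration j i)^T) 0 0).
  have dBsym r p q : dB r p q = dB r q p.
    by rewrite /dB; congr (partial r _ _); apply/funext => v; exact: Bsym.
  pose Gam i j k := \sum_p \sum_q
    christoffel B k p q (f z0) * tangent i z0 0 p * tangent j z0 0 q.
  apply: etrans (@variation_algebra R m (B (f z0)) dB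
    (fun p => velocity z0 0 p) (fun p => tangent i z0 0 p) (fun p => tangent j z0 0 p)
    (fun p => 'D_(space i) velocity z0 0 p) (fun p => 'D_(space j) velocity z0 0 p)
    (fun p => 'D_(space i) (tangent j) z0 0 p) (fun p => 'D_(space j) (tangent i) z0 0 p)
    (Gam i j) (Gam j i) (Bsym (f z0)) dBsym (G _ _) (G _ _)
    (normal_derivative i j) (normal_derivative j i)) _.
  have accE i' j' q : acceleration i' j' 0 q =
      'D_(space i') (tangent j') z0 0 q + Gam i' j' q.
    by rewrite /acceleration [LHS]mxE; congr (_ + _); rewrite mxE.
  congr (- (_ + _)); apply: etrans _ (esym (bilinearE _ _ _));
    by apply: eq_bigr => p _; apply: eq_bigr => q _; rewrite accE.
rewrite -E; apply: slope_sum => p; apply: slope_sum => q.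
apply: slopeM; last exact: slope_tangent.
by apply: slopeM; [exact: slope_tangent|exact: slope_comp_coord].
Qed.

End local_variation.

(** * Variations of an immersion *)

Lemma gram_entryE (R : realType) n m (J : 'M[R]_(n, m)) (B : 'M[R]_m) i j :
  (J *m B *m J^T) i j = (row i J *m B *m (row j J)^T) 0 0.
Proof.
rewrite -row_mul [LHS]mxE [RHS]mxE; apply: eq_bigr => k _.
by congr (_ * _); rewrite !mxE.
Qed.

Lemma derive_jacobian (R : realType) (V : normedModType R) m l
    (c : V -> 'rV[R]_m) (T : 'rV[R]_m -> 'rV[R]_l) z v y : c z = y ->
  differentiable c z -> differentiable T y ->
  'D_v (T \o c) z = 'D_v c z *m 'J T y.
Proof.
move=> <- dc dT; rewrite deriveE; last exact: differentiable_comp.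
by rewrite diff_comp //= (deriveE v dc) /jacobian mul_rV_lin1.
Qed.

Section variation.
Variables (R : realType) (n m : nat) (N : manifold R n) (M : manifold R m).
Variables (g : M -> 'M[R]_m) (F : N -> M) (Y : N -> 'rV[R]_m).
Variables (eps : R) (Fs : R -> N -> M).
Hypotheses (eps0 : 0 < eps) (gM : riem_metric g) (varF : smooth_variation F Y eps Fs).

Definition time_rep (a : chart R N n) (b : chart R M m)
    (z : (R^o * 'rV[R]_n)%type) : 'rV[R]_m := fwd b (Fs z.1 (bwd a z.2)).

Definition time_dom (a : chart R N n) (b : chart R M m) :
    set (R^o * 'rV[R]_n)%type :=
  [set z | [/\ `|z.1| < eps, img a z.2 & dom b (Fs z.1 (bwd a z.2))]].

Lemma Fs0 : Fs 0 = F. Proof. by case: varF. Qed.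

Lemma Fs_immersion s : `|s| < eps -> immersion (Fs s).
Proof. by case: varF => _ _ + _ _; exact. Qed.

Lemma Fs_smooth s : `|s| < eps -> smooth_map (Fs s).
Proof. by move=> /Fs_immersion []. Qed.

Lemma smooth_time_rep a b : atlas N a -> atlas M b ->
  smooth_on (time_dom a b) (time_rep a b).
Proof. by case: varF => _ + _ _ _; exact. Qed.

Lemma norm0_eps : `|0 : R| < eps. Proof. by rewrite normr0. Qed.

(** The joint continuity of the variation is what makes a single pair of charts
    serve for all small times and all nearby points. *)
Lemma near_time_dom a b u0 : img a u0 -> dom b (F (bwd a u0)) ->
  nbhs ((0 : R^o), u0) (time_dom a b).
Proof.
move=> au bu.
have cFs : {for (0, bwd a u0), continuous (fun z : R * N => Fs z.1 z.2)}.
  by case: varF => + _ _ _ _; apply; exact: norm0_eps.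
have bu' : dom b (Fs 0 (bwd a u0)) by rewrite Fs0.
have [[A B] /= [A0 Bx] AB] := cFs _ (near_dom bu').
have Bu : \forall u \near u0, B (bwd a u) by exact: (bwd_continuous au Bx).
exists ([set s | `|s| < eps] `&` A, [set u | img a u] `&` [set u | B (bwd a u)]).
  split => /=; last exact: filterI (near_img au) Bu.
  apply: filterI => //; apply/nbhs_ballP; exists eps => // s.
  by rewrite -ball_normE /= sub0r normrN.
move=> [s u] /= [[se As] [iu {}Bu]]; split => //.
exact: (AB (s, bwd a u) (conj As Bu)).
Qed.

Lemma bilin_in_sym (c : chart R M m) v : (bilin_in c g v)^T = bilin_in c g v.
Proof.
case: gM => _ gs _.
by rewrite /bilin_in !trmx_mul trmxK gs mulmxA.
Qed.

Lemma metric_unit p : g p \in unitmx.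
Proof. by case: gM => _ _ gp; apply: posdef_unit; exact: gp. Qed.

Lemma bilin_in_unit (c : chart R M m) v : atlas M c -> img c v ->
  bilin_in c g v \in unitmx.
Proof.
move=> ac cv; have [dv vE] := img_bwd cv.
have tu := to_std_unit ac dv; rewrite vE in tu.
by rewrite /bilin_in !unitmx_mul unitmx_tr tu metric_unit.
Qed.

Lemma pullback_time_rep a b s u i j : atlas N a -> atlas M b -> time_dom a b (s, u) ->
  bilin_in a (pullback (Fs s) g) u i j =
  (tangent (time_rep a b) i (s, u) *m bilin_in b g (time_rep a b (s, u)) *m
    (tangent (time_rep a b) j (s, u))^T) 0 0.
Proof.
move=> aN bM [/= se iu bu].
have sF := Fs_smooth se.
have [du uE] := img_bwd iu.
have := bilin_in_pullback sF aN bM g du bu; rewrite uE /= => ->.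
set J := 'J _ u.
have rJ k : row k J = tangent (time_rep a b) k (s, u).
  apply: etrans (row_jacobian k (rep_differentiable sF aN bM iu bu)) _.
  by rewrite /tangent derive_space.
by rewrite gram_entryE !rJ.
Qed.

(** The velocity read in charts, transported to the preferred chart of the image
    point, is [Y]: the variation field is prescribed in that chart only. *)
Lemma velocityE a b u : atlas N a -> atlas M b -> img a u ->
  dom b (F (bwd a u)) ->
  velocity (time_rep a b) (0, u) *m to_std b (fwd b (F (bwd a u))) = Y (bwd a u).
Proof.
move=> aN bM au bu; set x := bwd a u.
have nO := near_time_dom au bu.
have O0 := nbhs_singleton nO.
pose c (s : R^o) := time_rep a b (s, u).
have df := smooth_on_differentiable (smooth_time_rep aN bM) O0.
have dc : differentiable c 0.
  apply/derivable1_diffP; rewrite -derivable_time.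
  exact: diff_derivable df.
have c0 : c 0 = fwd b (F x) by rewrite /c /time_rep /= Fs0.
have dt := transition_differentiable bM (chart_at_atlas (F x)) bu (chart_at_dom (F x)).
rewrite to_stdE //.
have := derive_jacobian (1 : R^o) c0 dc dt; rewrite /velocity derive_time => <-.
have [_ _ _ _ /(_ x) dY] := varF.
rewrite -(@derive_val _ _ _ _ _ _ _ dY); apply: near_eq_derive.
have := near_fst nO; apply: filterS => s [_ _ /= bs].
by rewrite /c /time_rep /= fwdK.
Qed.

Lemma tangent0E a b u j : atlas N a -> atlas M b -> img a u ->
  dom b (F (bwd a u)) ->
  tangent (time_rep a b) j (0, u) *m to_std b (fwd b (F (bwd a u))) =
  row j (to_std a u) *m differential F (bwd a u).
Proof.
move=> aN bM au bu.
have sF : smooth_map F by rewrite -Fs0; apply: Fs_smooth; exact: norm0_eps.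
have [du uE] := img_bwd au.
have := to_std_differential sF aN bM du bu; rewrite uE => E.
rewrite -row_mul E row_mul; congr (_ *m _).
rewrite (row_jacobian j (rep_differentiable sF aN bM au bu)).
by rewrite /tangent derive_space /time_rep /= Fs0.
Qed.

Hypothesis normalY : forall x, Y x *m g (F x) *m (differential F x)^T = 0.

Lemma normal_time_rep a b u0 : atlas N a -> atlas M b -> img a u0 ->
  dom b (F (bwd a u0)) -> \forall u \near u0, forall j,
  (velocity (time_rep a b) (0, u) *m bilin_in b g (time_rep a b (0, u)) *m
    (tangent (time_rep a b) j (0, u))^T) 0 0 = 0.
Proof.
move=> aN bM au bu; apply: filterS (near_snd0 (near_time_dom au bu)).
move=> u [/= _ iu]; rewrite Fs0 => du j.
rewrite /bilin_in /time_rep /= Fs0 fwdK //.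
set T := to_std b _.
have -> : velocity (time_rep a b) (0, u) *m (T *m g (F (bwd a u)) *m T^T) *m
    (tangent (time_rep a b) j (0, u))^T =
  (velocity (time_rep a b) (0, u) *m T) *m g (F (bwd a u)) *m
    (tangent (time_rep a b) j (0, u) *m T)^T by rewrite trmx_mul !mulmxA.
by rewrite velocityE // tangent0E // trmx_mul mulmxA normalY mul0mx mxE.
Qed.

Lemma slope_metric_entry a b u0 i j : atlas N a -> atlas M b -> img a u0 ->
  dom b (F (bwd a u0)) ->
  let f := time_rep a b in
  let T i j := (velocity f (0, u0) *m bilin_in b g (f (0, u0)) *m
    (acceleration f u0 (bilin_in b g) i j)^T) 0 0 in
  slope (fun s u => bilin_in a (pullback (Fs s) g) u i j) u0 (- (T i j + T j i)).
Proof.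
move=> aN bM au bu f T.
have nO := near_time_dom au bu; have [_ _ bs] := nbhs_singleton nO.
have sf := smooth_time_rep aN bM.
have fO z : time_dom a b z -> img b (f z) by move=> [_ _ bz]; exact: imgP.
have sB : smooth_on (img b) (bilin_in b g) by case: gM => + _ _; exact.
have Bs v p q : bilin_in b g v p q = bilin_in b g v q p.
  by rewrite -[in LHS]bilin_in_sym mxE.
have Bu : bilin_in b g (f (0, u0)) \in unitmx by apply: bilin_in_unit => //; exact: imgP.
have := first_variation_metric nO sf fO sB Bs Bu (normal_time_rep aN bM au bu) i j.
apply: slope_near; apply: filterS nO => -[s u] Ou /=.
by rewrite (pullback_time_rep _ _ aN bM Ou).
Qed.

Lemma pullback_sym (G : N -> M) x : (forall p, (g p)^T = g p) -> (pullback G g x)^T = pullback G g x.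
Proof. by move=> gs; rewrite /pullback !trmx_mul trmxK gs mulmxA. Qed.

Lemma pullback_posdef (G : N -> M) x : immersion G -> posdef (pullback G g x).
Proof.
case: gM => _ _ gp [_ /(_ x) rf] v v0; rewrite /pullback.
set D := differential G x in rf *.
have -> : v *m (D *m g (G x) *m D^T) *m v^T = (v *m D) *m g (G x) *m (v *m D)^T.
  by rewrite trmx_mul !mulmxA.
apply: gp; apply: contra_neq v0 => vD.
by apply: (row_free_inj rf); rewrite vD mul0mx.
Qed.

Lemma det_bilin_in_gt0 a u : atlas N a -> img a u -> 0 < \det (bilin_in a (pullback F g) u).
Proof.
move=> aN au; have [du uE] := img_bwd au.
have iF : immersion F by rewrite -Fs0; apply: Fs_immersion; exact: norm0_eps.
have tu := to_std_unit aN du; rewrite uE in tu.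
rewrite /bilin_in !det_mulmx det_tr mulrAC.
rewrite mulr_gt0 //; last exact: posdef_det_gt0 (pullback_posdef _ iF).
by rewrite -expr2 exprn_even_gt0 //= -unitfE -unitmxE.
Qed.

End variation.

(** * Volume densities *)

Lemma continuous_near (T U : topologicalType) (f h : T -> U) u :
  {near u, f =1 h} -> {for u, continuous f} -> {for u, continuous h}.
Proof.
move=> fh; rewrite /prop_for /continuous_at -(nbhs_singleton fh).
by move=> cf; apply: cvg_trans cf; apply: near_eq_cvg; apply: filterS fh => v ->.
Qed.

(** The cofactors are the entries of the inverse times the determinant; by
    symmetry of [h] both terms contribute the same trace. *)
Lemma sum_cofactor_sym (R : realType) n (h : 'M[R]_n) (T : 'I_n -> 'I_n -> R) :
  h \in unitmx -> h^T = h ->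
  \sum_i \sum_j - (T i j + T j i) * cofactor h i j =
  - (2 * \det h * \sum_i \sum_j invmx h i j * T i j).
Proof.
move=> uh hs.
have inv_sym i j : invmx h j i = invmx h i j.
  by rewrite -[in LHS]hs -trmx_inv mxE.
have cofE i j : cofactor h i j = \det h * invmx h i j.
  rewrite -inv_sym /invmx uh mxE mxE mulrA divff ?mul1r //.
  by rewrite -unitfE -unitmxE.
transitivity (- (\det h * \sum_i \sum_j invmx h i j * T i j) -
    (\det h * \sum_i \sum_j invmx h i j * T j i)).
  rewrite -opprD -mulrDr -big_split /= mulr_sumr -sumrN.
  apply: eq_bigr => i _; rewrite -big_split /= mulr_sumr -sumrN.
  by apply: eq_bigr => j _; rewrite cofE; ring.
rewrite [in X in _ - X]exchange_big /=.
have -> : \sum_j \sum_i invmx h i j * T j i = \sum_i \sum_j invmx h i j * T i j.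
  by apply: eq_bigr => i _; apply: eq_bigr => j _; rewrite inv_sym.
by ring.
Qed.

Lemma slope_sqrt_double (R : realType) (U : topologicalType) (w : R -> U -> R) u0 D S :
  slope w u0 (- (2 * D * S)) -> w 0 u0 = D -> 0 < D ->
  slope (fun s u => Num.sqrt (w s u)) u0 (- (Num.sqrt D * S)).
Proof.
move=> sw w0D D0; subst D; have := slope_sqrt sw D0; congr (slope _ _ _).
have s0 : Num.sqrt (w 0 u0) != 0 by rewrite gt_eqF // sqrtr_gt0.
move: s0 (sqr_sqrtr (ltW D0)); move: (Num.sqrt _) => t t0 <-.
by field.
Qed.

Lemma slopeM_eq (R : realType) (U : topologicalType) (w1 w2 : R -> U -> R) u0
    d1 d2 c1 c2 : slope w1 u0 d1 -> slope w2 u0 d2 -> w1 0 u0 = c1 -> w2 0 u0 = c2 ->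
  slope (fun s u => w1 s u * w2 s u) u0 (d1 * c2 + c1 * d2).
Proof. by move=> s1 s2 <- <-; exact: slopeM. Qed.

Section conformal_density.
Variables (R : realType) (n m : nat) (N : manifold R n) (M : manifold R m).
Variables (g : M -> 'M[R]_m) (psi : M -> R).

Lemma det_bilin_in (c : chart R N n) (h : N -> 'M[R]_n) u :
  Num.sqrt (\det (bilin_in c h u)) =
  `|\det (to_std c u)| * Num.sqrt (\det (h (bwd c u))).
Proof.
rewrite /bilin_in !det_mulmx det_tr mulrAC -expr2 sqrtrM ?sqr_ge0 //.
by rewrite sqrtr_sqr.
Qed.

Lemma pullback_conformal (G : N -> M) alpha x :
  pullback G (conformal alpha psi g) x = expR (alpha * psi (G x)) *: pullback G g x.
Proof. by rewrite /pullback /conformal -scalemxAr -scalemxAl. Qed.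

(** The induced metric is scaled by [exp(alpha psi)] in [n] dimensions, and the
    density is a square root. *)
Lemma conformal_density (G : N -> M) (c : chart R N n) alpha u :
  Num.sqrt (\det (bilin_in c (pullback G (conformal alpha psi g)) u)) =
  expR (alpha * n%:R / 2 * psi (G (bwd c u))) *
  Num.sqrt (\det (bilin_in c (pullback G g) u)).
Proof.
rewrite !det_bilin_in pullback_conformal detZ mulrCA; congr (_ * _).
set t := psi _.
have -> : expR (alpha * t) ^+ n = expR (alpha * n%:R / 2 * t) ^+ 2.
  by rewrite -!expRM_natl; congr expR; field.
by rewrite sqrtrM ?sqr_ge0 // sqrtr_sqr gtr0_norm // expR_gt0.
Qed.

Hypotheses (gM : riem_metric g) (spsi : smooth_fun psi).

Lemma density_continuous (G : N -> M) (c : chart R N n) u : smooth_map G ->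
  atlas N c -> img c u ->
  {for u, continuous (fun u => Num.sqrt
    (\det (bilin_in c (pullback G (conformal 2 psi g)) u)))}.
Proof.
move=> sG cN cu; pose b := chart_at (G (bwd c u)).
have bM : atlas M b by exact: chart_at_atlas.
have bu : dom b (G (bwd c u)) by exact: chart_at_dom.
pose phi := fwd b \o G \o bwd c.
have sphi : smooth_on [set u | img c u /\ dom b (G (bwd c u))] phi.
  by case: sG => _; exact.
have nrep := near_rep sG cu bu.
have cphi : {for u, continuous phi}.
  exact: smooth_on_continuous sphi _ (conj cu bu).
have ib : img b (phi u) by exact: imgP.
apply: (@continuous_near _ _ (fun v => expR (2 * n%:R / 2 * psi (G (bwd c v))) *
  Num.sqrt (\det (bilin_in c (pullback G g) v)))).
  by apply: filterE => v; rewrite conformal_density.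
apply: continuousM.
  apply: (@continuous_comp _ _ _ (fun v => 2 * n%:R / 2 * psi (G (bwd c v))) expR);
    last exact: continuous_expR.
  apply: (@continuous_near _ _ (fun v => 2 * n%:R / 2 * (psi \o bwd b) (phi v))).
    by apply: filterS nrep => v [_ bv] /=; rewrite /phi /= fwdK.
  have cp : {for u, continuous ((psi \o bwd b) \o phi)}.
    apply: continuous_comp => //.
    exact: smooth_on_continuous (spsi bM) _ ib.
  exact: cvgMl_tmp cp.
apply: (@continuous_comp _ _ _ (fun v => \det (bilin_in c (pullback G g) v))
  (@Num.sqrt R)); last exact: sqrt_continuous.
apply: (@cvg_det _ _ (nbhs u)) => i j.
apply: (@continuous_near _ _ (fun v => \sum_p \sum_q
  partial i phi v 0 p * bilin_in b g (phi v) p q * partial j phi v 0 q)).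
  apply: filterS nrep => v [cv bv]; have [dv vE] := img_bwd cv.
  have rJ k := row_jacobian k (rep_differentiable sG cN bM cv bv).
  have := bilin_in_pullback sG cN bM g dv bv; rewrite vE /= => ->.
  by rewrite gram_entryE !rJ bilinearE.
apply: (@cvg_sum_fin _ _ (nbhs u)) => p; apply: (@cvg_sum_fin _ _ (nbhs u)) => q.
have sB : smooth_on (img b) (bilin_in b g) by case: gM => + _ _; exact.
apply: cvgM; last first.
  apply: coord_cont.
  exact: smooth_on_continuous (smooth_on_derive sphi _) _ (conj cu bu).
apply: cvgM.
  apply: coord_cont.
  exact: smooth_on_continuous (smooth_on_derive sphi _) _ (conj cu bu).
apply: (@continuous_comp _ _ _ phi (fun v => bilin_in b g v p q)) => //.
by apply: coord_cont; exact: smooth_on_continuous sB _ ib.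
Qed.

End conformal_density.

Section first_variation.
Variables (R : realType) (n m : nat) (N : manifold R n) (M : manifold R m).
Variables (g : M -> 'M[R]_m) (psi : M -> R) (F : N -> M) (Y : N -> 'rV[R]_m).
Variables (eps : R) (Fs : R -> N -> M).
Hypotheses (eps0 : 0 < eps) (gM : riem_metric g) (spsi : smooth_fun psi).
Hypothesis varF : smooth_variation F Y eps Fs.
Hypothesis normalY : forall x, Y x *m g (F x) *m (differential F x)^T = 0.

(** The derivative of the density of [exp(2 psi) g] in arbitrary charts, where
    [T] pairs the velocity with the covariant derivatives of the tangent
    vectors and [dpsi] is the derivative of [psi] along the velocity. *)
Lemma slope_density_chart a b u0 : atlas N a -> atlas M b -> img a u0 ->
  dom b (F (bwd a u0)) ->
  let f := time_rep Fs a b in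
  let h := bilin_in a (pullback F g) u0 in
  let T i j := (velocity f (0, u0) *m bilin_in b g (f (0, u0)) *m
    (acceleration f u0 (bilin_in b g) i j)^T) 0 0 in
  let dpsi := \sum_r velocity f (0, u0) 0 r *
    partial r (psi \o bwd b : _ -> R^o) (f (0, u0)) in
  slope (fun s u => Num.sqrt
      (\det (bilin_in a (pullback (Fs s) (conformal 2 psi g)) u))) u0
    (- (expR (n%:R * psi (F (bwd a u0))) * Num.sqrt (\det h) *
      (\sum_i \sum_j invmx h i j * T i j - n%:R * dpsi))).
Proof.
move=> aN bM au bu f h T dpsi.
have nO := near_time_dom eps0 varF au bu.
have sf : smooth_on (time_dom eps Fs a b) f := smooth_time_rep varF aN bM.
have fO z : time_dom eps Fs a b z -> img b (f z) by move=> [_ _ bz]; exact: imgP.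
have F0 := Fs0 varF.
have h0 : 0 < \det h by exact: det_bilin_in_gt0 eps0 gM varF _ _ aN au.
have sD : slope (fun s u => \det (bilin_in a (pullback (Fs s) g) u)) u0
    (- (2 * \det h * \sum_i \sum_j invmx h i j * T i j)).
  have hs : h^T = h.
    have gs : forall p, (g p)^T = g p by case: gM.
    by rewrite /h /bilin_in trmx_mul trmx_mul trmxK (pullback_sym _ _ gs) mulmxA.
  have hu : h \in unitmx by rewrite unitmxE unitfE gt_eqF.
  rewrite -sum_cofactor_sym //.
  have := @slope_det R _ n (fun s u => bilin_in a (pullback (Fs s) g) u) u0
    (\matrix_(i, j) - (T i j + T j i)).
  rewrite F0; under eq_bigr do under eq_bigr do rewrite mxE.
  apply=> i j; rewrite mxE.
  exact: (slope_metric_entry eps0 gM varF normalY i j aN bM au bu).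
have sQ : slope (fun s u => Num.sqrt (\det (bilin_in a (pullback (Fs s) g) u))) u0
    (- (Num.sqrt (\det h) * \sum_i \sum_j invmx h i j * T i j)).
  by apply: (slope_sqrt_double sD _ h0); rewrite F0.
have sE : slope (fun s u => expR (n%:R * psi (Fs s (bwd a u)))) u0
    (dpsi * (n%:R * expR (n%:R * psi (F (bwd a u0))))).
  have := slope_exp_comp nO sf fO n%:R (spsi bM).
  rewrite -/dpsi /= {2}/f /time_rep /= F0 fwdK //.
  apply: slope_near; apply: filterS nO => -[s u] [_ _ /= bs].
  by rewrite /f /time_rep /= fwdK.
have w10 : expR (n%:R * psi (Fs 0 (bwd a u0))) = expR (n%:R * psi (F (bwd a u0))).
  by rewrite F0.
have w20 : Num.sqrt (\det (bilin_in a (pullback (Fs 0) g) u0)) = Num.sqrt (\det h).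
  by rewrite F0.
have := slopeM_eq sE sQ w10 w20; set d := (_ + _) => sd.
have -> : - (expR (n%:R * psi (F (bwd a u0))) * Num.sqrt (\det h) *
   (\sum_i \sum_j invmx h i j * T i j - n%:R * dpsi)) = d by rewrite /d; ring.
apply: slope_near sd; apply: filterE => -[s u] /=.
by rewrite conformal_density (_ : 2 * n%:R / 2 = n%:R :> R); last by field.
Qed.

End first_variation.

(** * Identification with the generalized mean curvature *)

Section first_variation_value.
Variables (R : realType) (n m : nat) (N : manifold R n) (M : manifold R m).
Variables (g : M -> 'M[R]_m) (psi : M -> R) (F : N -> M) (Y : N -> 'rV[R]_m).
Variables (eps : R) (Fs : R -> N -> M).
Hypotheses (eps0 : 0 < eps) (gM : riem_metric g) (spsi : smooth_fun psi).
Hypothesis varF : smooth_variation F Y eps Fs.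
Hypothesis normalY : forall x, Y x *m g (F x) *m (differential F x)^T = 0.

Lemma tangent_chart_at x j :
  tangent (time_rep Fs (chart_at x) (chart_at (F x))) j (0, fwd (chart_at x) x) =
  row j (differential F x).
Proof.
have ax := chart_at_dom x; have bx := chart_at_dom (F x).
have bx' : dom (chart_at (F x)) (F (bwd (chart_at x) (fwd (chart_at x) x))).
  by rewrite fwdK.
have := tangent0E eps0 varF j (chart_at_atlas x) (chart_at_atlas (F x)) (imgP ax) bx'.
by rewrite fwdK // !to_std_chart_at mulmx1 row1 -rowE.
Qed.

Lemma velocity_chart_at x :
  velocity (time_rep Fs (chart_at x) (chart_at (F x))) (0, fwd (chart_at x) x) = Y x.
Proof.
have ax := chart_at_dom x; have bx := chart_at_dom (F x).
have bx' : dom (chart_at (F x)) (F (bwd (chart_at x) (fwd (chart_at x) x))).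
  by rewrite fwdK.
have := velocityE eps0 varF (chart_at_atlas x) (chart_at_atlas (F x)) (imgP ax) bx'.
by rewrite fwdK // to_std_chart_at mulmx1.
Qed.

Lemma time_rep_chart_at x :
  time_rep Fs (chart_at x) (chart_at (F x)) (0, fwd (chart_at x) x) =
  fwd (chart_at (F x)) (F x).
Proof. by rewrite /time_rep /= (Fs0 varF) fwdK //; exact: chart_at_dom. Qed.

Lemma acceleration_chart_at x i j :
  acceleration (time_rep Fs (chart_at x) (chart_at (F x))) (fwd (chart_at x) x)
    (bilin_in (chart_at (F x)) g) i j = nabla_dF g F x i j.
Proof.
set b := chart_at (F x); set a := chart_at x; set f := time_rep Fs a b.
have tE k p : tangent f k (0, fwd a x) 0 p = differential F x k p.
  by rewrite /f tangent_chart_at [LHS]mxE.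
have fE : f (0, fwd a x) = fwd b (F x) by exact: time_rep_chart_at.
have e1 : 'D_(0, delta_mx 0 i) (tangent f j) (0, fwd a x) =
    partial i (partial j (fwd b \o F \o bwd a)) (fwd a x).
  have ef : (fun v => f (0, v)) = fwd b \o F \o bwd a.
    by apply/funext => v; rewrite /f /time_rep /= (Fs0 varF).
  have et : (fun u => tangent f j (0, u)) = partial j (fwd b \o F \o bwd a).
    apply/funext => u; apply: etrans (derive_space f 0 u (delta_mx 0 j)) _.
    exact: (congr1 (fun h => 'D_(delta_mx 0 j) h u) ef).
  apply: etrans (derive_space (tangent f j) 0 (fwd a x) (delta_mx 0 i)) _.
  exact: (congr1 (fun h => 'D_(delta_mx 0 i) h (fwd a x)) et).
apply: congr2 e1 _; apply/rowP => k; rewrite [LHS]mxE [RHS]mxE.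
apply: eq_bigr => p _; apply: eq_bigr => q _.
exact: (congr2 *%R (congr2 *%R (congr1 (christoffel (bilin_in b g) k p q) fE)
  (tE i p)) (tE j q)).
Qed.

(** [Y] is normal, so pairing with [Y] does not see the tangential part that the
    projection removes. *)
Lemma normal_projE x v :
  (Y x *m g (F x) *m (normal_proj g F x v)^T) = Y x *m g (F x) *m v^T.
Proof.
rewrite /normal_proj linearB /= mulmxBr.
rewrite [X in _ - _ *m X]trmx_mul [X in _ - X]mulmxA normalY mul0mx subr0 //.
Qed.

Lemma velocity_mean_curvature x :
  (Y x *m g (F x) *m (mean_curvature g F x)^T) 0 0 =
  \sum_i \sum_j invmx (pullback F g x) i j *
    (Y x *m g (F x) *m (nabla_dF g F x i j)^T) 0 0.
Proof.
rewrite /mean_curvature linear_sum mulmx_sumr summxE; apply: eq_bigr => i _.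
rewrite linear_sum mulmx_sumr summxE; apply: eq_bigr => j _.
by rewrite linearZ /= -scalemxAr mxE /second_fundamental_form normal_projE.
Qed.

Lemma velocity_gradient x :
  (Y x *m g (F x) *m (gradient g psi (F x))^T) 0 0 =
  \sum_r Y x 0 r * partial r (psi \o bwd (chart_at (F x)) : _ -> R^o)
    (fwd (chart_at (F x)) (F x)).
Proof.
have gu : g (F x) \in unitmx by exact: metric_unit.
have gs : (g (F x))^T = g (F x) by case: gM.
rewrite /gradient; set d := \row_a _.
rewrite trmx_mul trmx_inv gs mulmxA mulmxK // mxE.
by apply: eq_bigr => r _; rewrite !mxE.
Qed.

Lemma metric_sym (v w : 'rV[R]_m) p :
  (v *m g p *m w^T) 0 0 = (w *m g p *m v^T) 0 0.
Proof.
have gs : (g p)^T = g p by case: gM.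
transitivity ((v *m g p *m w^T)^T 0 0); first by rewrite [RHS]mxE.
by rewrite trmx_mul trmxK trmx_mul gs mulmxA.
Qed.

Local Notation K := (generalized_mean_curvature g psi F).
Local Notation gtilde := (conformal 2 psi g).
Local Notation ghat := (conformal (2 * n%:R / (n%:R + 2)) psi g).

Lemma velocity_generalized_mean_curvature x :
  (K x *m g (F x) *m (Y x)^T) 0 0 =
  \sum_i \sum_j invmx (pullback F g x) i j *
    (Y x *m g (F x) *m (nabla_dF g F x i j)^T) 0 0 -
  n%:R * \sum_r Y x 0 r * partial r (psi \o bwd (chart_at (F x)) : _ -> R^o)
    (fwd (chart_at (F x)) (F x)).
Proof.
rewrite metric_sym /generalized_mean_curvature linearB linearZ /= mulmxBr.
rewrite -scalemxAr normal_projE [LHS]mxE velocity_mean_curvature.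
by rewrite [X in _ + X]mxE [X in _ - X]mxE velocity_gradient.
Qed.

(** In the preferred charts all changes of coordinates at [x] are the identity,
    and the derivative becomes the integrand of the inner product. *)
Lemma slope_density_chart_at x :
  slope (fun s u => Num.sqrt (\det (bilin_in (chart_at x) (pullback (Fs s) gtilde) u)))
    (fwd (chart_at x) x)
    (- ((K x *m ghat (F x) *m (Y x)^T) 0 0 *
        Num.sqrt (\det (pullback F ghat x)))).
Proof.
have ax := chart_at_dom x; have bx := chart_at_dom (F x).
have bx' : dom (chart_at (F x)) (F (bwd (chart_at x) (fwd (chart_at x) x))).
  by rewrite fwdK.
have := slope_density_chart eps0 gM spsi varF normalY (chart_at_atlas x)
  (chart_at_atlas (F x)) (imgP ax) bx'.
set d := (X in slope _ _ X -> _); set d' := (X in _ -> slope _ _ X).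
suff -> : d = d' by [].
rewrite /d /d' time_rep_chart_at velocity_chart_at fwdK // !bilin_in_chart_at.
have -> : \sum_i \sum_j invmx (pullback F g x) i j * (Y x *m g (F x) *m
    (acceleration (time_rep Fs (chart_at x) (chart_at (F x))) (fwd (chart_at x) x)
    (bilin_in (chart_at (F x)) g) i j)^T) 0 0 =
  \sum_i \sum_j invmx (pullback F g x) i j *
    (Y x *m g (F x) *m (nabla_dF g F x i j)^T) 0 0.
  by apply: eq_bigr => i _; apply: eq_bigr => j _; rewrite acceleration_chart_at.
rewrite -velocity_generalized_mean_curvature.
have := conformal_density g psi F (chart_at x) (2 * n%:R / (n%:R + 2))
  (fwd (chart_at x) x).
rewrite !bilin_in_chart_at fwdK // => ->.
rewrite /conformal -scalemxAr -scalemxAl [in RHS]mxE.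
set t := psi (F x); set q := (_ *m _) 0 0.
have n2 : n%:R + 2 != 0 :> R by rewrite -natrD pnatr_eq0 addn2.
(* the exponent of the rescaling of the inner product is chosen for this *)
have -> : n%:R * t = 2 * n%:R / (n%:R + 2) * t +
    2 * n%:R / (n%:R + 2) * n%:R / 2 * t by field.
by rewrite expRD; ring.
Qed.

(** In a general chart the density differs from that in the preferred chart by
    the factor [|det (to_std c u)|].  This factor varies with the point, so the
    existence of the slope comes from [slope_density_chart]; it is constant in
    time, so the value comes from the preferred chart. *)
Lemma slope_density c u : atlas N c -> img c u ->
  slope (fun s u => Num.sqrt (\det (bilin_in c (pullback (Fs s) gtilde) u))) u
    (- ((K (bwd c u) *m ghat (F (bwd c u)) *m (Y (bwd c u))^T) 0 0 *
        Num.sqrt (\det (bilin_in c (pullback F ghat) u)))).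
Proof.
move=> cN cu; set x := bwd c u.
have bM := chart_at_atlas (F x); have bx : dom (chart_at (F x)) (F (bwd c u)).
  exact: chart_at_dom.
have [d sc] : exists d, slope (fun s u =>
    Num.sqrt (\det (bilin_in c (pullback (Fs s) gtilde) u))) u d.
  eexists; exact: (slope_density_chart eps0 gM spsi varF normalY cN bM cu bx).
suff dE : d = - ((K x *m ghat (F x) *m (Y x)^T) 0 0 *
    Num.sqrt (\det (bilin_in c (pullback F ghat) u))) by rewrite dE in sc.
have dc := slope_is_derive sc.
have da := slope_is_derive (slope_density_chart_at x).
have xK : bwd (chart_at x) (fwd (chart_at x) x) = x.
  by rewrite fwdK //; exact: chart_at_dom.
pose w (s : R) := Num.sqrt (\det (pullback (Fs s) gtilde x)).
have wa : (fun s => Num.sqrt (\det (bilin_in (chart_at x) (pullback (Fs s) gtilde)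
    (fwd (chart_at x) x)))) = w.
  by apply/funext => s; rewrite bilin_in_chart_at.
have wc : (fun s => Num.sqrt (\det (bilin_in c (pullback (Fs s) gtilde) u))) =
    (fun s => `|\det (to_std c u)| * w s).
  by apply/funext => s; rewrite det_bilin_in.
rewrite wa in da; rewrite wc in dc.
have := is_deriveZ `|\det (to_std c u)| da => dc'.
rewrite -(@derive_val _ _ _ _ _ _ _ dc).
rewrite (@derive_val _ _ _ _ _ _ _ dc') det_bilin_in /GRing.scale /=.
by ring.
Qed.

End first_variation_value.

(** * Differentiation of the integral over a chart *)

Section chart_integral.
Variables (R : realType) (n : nat) (N : manifold R n).
Hypothesis compactN : compact [set: N].
Variables (c : chart R N n) (rho : N -> R).
Hypotheses (crho : continuous (rho : N -> R^o)).
Hypothesis suprho : closure [set x | rho x != 0] `<=` dom c.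

Let K := fwd c @` closure [set x | rho x != 0].

Let compactK : compact K.
Proof.
apply: continuous_compact.
  apply: continuous_in_subspaceT => x /set_mem /suprho; exact: fwd_continuous.
apply: subclosed_compact compactN _ => //; exact: closed_closure.
Qed.

Let closedK : closed K.
Proof. by apply: compact_closed compactK; exact: norm_hausdorff. Qed.

Let K_img u : K u -> img c u.
Proof. by move=> [x /suprho cx <-]; exact: imgP. Qed.

Let rho0 u : img c u -> ~ K u -> rho (bwd c u) = 0.
Proof.
move=> cu nK; apply: contrapT => /eqP r0; apply: nK.
have [_ uE] := img_bwd cu; exists (bwd c u) => //.
exact: subset_closure.
Qed.

(** One term of the integral over the manifold: [w] cut off by the function
    [rho] of the partition of unity, and extended by [0] outside the chart. *)
Definition localized (w : 'rV[R]_n -> R) : 'rV[R]_n -> R :=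
  (fun u => rho (bwd c u) * w u) \_ (img c).

Lemma localized_img w u : img c u -> localized w u = rho (bwd c u) * w u.
Proof. by move=> cu; rewrite /localized patchE mem_set. Qed.

Lemma localized_out w u : ~ K u -> localized w u = 0.
Proof.
move=> nK; rewrite /localized patchE; case: ifPn => // /set_mem cu.
by rewrite rho0 // mul0r.
Qed.

Let near_nK u : ~ K u -> \forall v \near u, ~ K v.
Proof. by move=> nK; apply: open_nbhs_nbhs; split => //; rewrite openC. Qed.

Let rho_bwd u : img c u -> {for u, continuous (fun v => rho (bwd c v))}.
Proof.
move=> cu; apply: (@continuous_comp _ _ _ (bwd c) rho).
  exact: bwd_continuous.
exact: crho.
Qed.

(** The closed support of [rho] is compact and inside the chart domain, so near
    every point either the cut-off product is continuous or it vanishes. *)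
Lemma localized_continuous w : (forall u, img c u -> {for u, continuous w}) ->
  continuous (localized w).
Proof.
move=> cw u; have [Ku|nK] := pselect (K u).
  have cu := K_img Ku.
  apply: (@continuous_near _ _ (fun v => rho (bwd c v) * w v)).
    by apply: filterS (near_img cu) => v cv; rewrite localized_img.
  by apply: continuousM; [exact: rho_bwd|exact: cw].
apply: (@continuous_near _ _ (fun=> 0)); last exact: (@continuous_cst_at _ R).
by apply: filterS (near_nK nK) => v nKv; exact: esym (localized_out w nKv).
Qed.

Lemma localized_slope (w : R -> 'rV[R]_n -> R) (d : 'rV[R]_n -> R) u :
  (forall u, img c u -> slope w u (d u)) ->
  slope (fun s => localized (w s)) u (localized d u).
Proof.
move=> sw; have [Ku|nK] := pselect (K u).
  have cu := K_img Ku; rewrite localized_img //.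
  apply: (@slope_near _ _ (fun s v => rho (bwd c v) * w s v)).
    have nc := near_snd R (near_img cu).
    by apply: (near_filterS2 _ nc nc) => -[s v] /= cv _; rewrite localized_img.
  have := slopeM (slope_cst (rho_bwd cu)) (sw u cu).
  by rewrite mul0r add0r.
rewrite localized_out //.
apply: (@slope_near _ _ (fun _ _ => 0)); last first.
  by apply: (@slope_cst _ _ (fun=> 0)); exact: (@continuous_cst_at _ R).
have nK' := near_snd R (near_nK nK).
by apply: (near_filterS2 _ nK' nK') => -[s v] /= nKv _; exact: esym (localized_out (w s) nKv).
Qed.

Lemma localized_support : exists2 r, 0 <= r & forall w,
  continuous (localized w) -> compactly_supported r (localized w).
Proof.
have [A [Ar AK]] := compact_bounded compactK.
exists (`|A| + 1); first by rewrite addr_ge0.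
move=> w cw; split=> // u ru; apply: localized_out => Ku.
move: ru; apply/negP; rewrite -leNgt; apply: (AK (`|A| + 1)) Ku.
by apply: le_lt_trans (ler_norm A) _; rewrite ltrDl.
Qed.

Lemma localized_integral_derive (w : R -> 'rV[R]_n -> R) (d : 'rV[R]_n -> R) :
  (forall u, img c u -> slope w u (- d u)) ->
  (\forall s \near (0 : R), forall u, img c u -> {for u, continuous (w s)}) ->
  is_derive (0 : R^o) 1 (fun s : R^o => integral_rV (localized (w s)) : R^o)
    (- integral_rV (localized d)).
Proof.
move=> sw cw; have [r r0 rsup] := localized_support.
have sl u := @localized_slope w (fun v => - d v) u sw.
have locN : localized d = fun u => - localized (fun v => - d v) u.
  apply/funext => u; rewrite /localized !patchE; case: ifP => _.
    by rewrite mulrN opprK.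
  exact: (esym (oppr0 R)).
have sd := rsup _ (slope_continuous sl).
rewrite locN (integral_rVN r0 sd) opprK.
apply: integral_rV_derive sl r0 _.
by apply: filterS cw => s ws; apply: rsup; exact: localized_continuous.
Qed.

End chart_integral.

Lemma onth_derive_sum (R : realType) (A : Type) (P : seq A) (f : A -> R -> R)
    (d : A -> R) :
  (forall i a, onth P i = Some a -> is_derive (0 : R^o) 1 (f a : R^o -> R^o) (d a)) ->
  is_derive (0 : R^o) 1 (fun s : R^o => \sum_(a <- P) f a s : R^o) (\sum_(a <- P) d a).
Proof.
elim: P => [|a P IH] h.
  rewrite big_nil (_ : (fun _ => _) = cst 0); first exact: is_derive_cst.
  by apply/funext => s; rewrite big_nil.
rewrite big_cons (_ : (fun _ => _) = (fun s : R^o => f a s + \sum_(a <- P) f a s : R^o)).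
  by apply: is_derive_add; [exact: (h 0%N)|apply: IH => i b /(h i.+1)].
by apply/funext => s; rewrite big_cons.
Qed.

(** * The gradient flow identity *)

Theorem proposition4p1 (R : realType) (n : nat) (M : manifold R (n + n))
    (compactM : compact [set: M]) (k : kahler M) (lambda : R) (psi : M -> R)
    (almostE : almost_einstein k lambda psi) :
  let gbar := metric k in
  let gtilde := conformal 2 psi gbar in
  let ghat := conformal (2 * n%:R / (n%:R + 2)) psi gbar in
  forall (N : manifold R n) (compactN : compact [set: N])
    (F : N -> M) (immF : immersion F)
    (Y : N -> 'rV[R]_(n + n)) (normalY : normal_field gbar F Y)
    (eps : R) (eps_gt0 : 0 < eps)
    (Fs : R -> N -> M) (varF : smooth_variation F Y eps Fs),
  is_derive (0 : R^o) 1 (fun s : R^o => volume gtilde (Fs s) : R^o)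
    (- L2_metric ghat F (generalized_mean_curvature gbar psi F) Y).
Proof.
move=> gbar gtilde ghat N compactN F immF Y [_ normalY] eps eps_gt0 Fs varF.
have gM : riem_metric gbar by exact: metric_riem.
have [spsi _] := almostE.
have [Pi _] := chosen_partitionP compactN.
rewrite /volume /L2_metric /riem_integral -sumrN.
apply: onth_derive_sum => i cr /Pi [crN crho _ crsup].
pose w s u := Num.sqrt (\det (bilin_in cr.1 (pullback (Fs s) gtilde) u)).
pose d u := (generalized_mean_curvature gbar psi F (bwd cr.1 u) *m
  ghat (F (bwd cr.1 u)) *m (Y (bwd cr.1 u))^T) 0 0 *
  Num.sqrt (\det (bilin_in cr.1 (pullback F ghat) u)).
have wE : (fun s : R^o => integral_rV ((fun u => cr.2 (bwd cr.1 u) * 1 *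
    Num.sqrt (\det (bilin_in cr.1 (pullback (Fs s) gtilde) u))) \_ (img cr.1))) =
  (fun s : R^o => integral_rV (localized cr.1 cr.2 (w s))).
  apply/funext => s; rewrite /localized; congr (integral_rV (_ \_ _)).
  by apply/funext => u; rewrite mulr1.
have dE : (fun u => cr.2 (bwd cr.1 u) * (generalized_mean_curvature gbar psi F
    (bwd cr.1 u) *m ghat (F (bwd cr.1 u)) *m (Y (bwd cr.1 u))^T) 0 0 *
    Num.sqrt (\det (bilin_in cr.1 (pullback F ghat) u))) \_ (img cr.1) =
  localized cr.1 cr.2 d.
  rewrite /localized; congr (_ \_ _).
  by apply/funext => u; rewrite mulrA.
rewrite wE dE.
apply: (localized_integral_derive compactN crho crsup).
  move=> u cu; have sd := slope_density eps_gt0 gM spsi varF normalY crN cu.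
  exact: sd.
have neps : \forall s \near (0 : R), `|s| < eps.
  apply/nbhs_ballP; exists eps => // s.
  by rewrite -ball_normE /= sub0r normrN.
apply: filterS neps => s seps u cu.
have dc := density_continuous gM spsi (Fs_smooth varF seps) crN cu.
exact: dc.
Qed.
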